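(* The splitting $\boldsymbol V^{DG}=\boldsymbol V^{CR}\oplus\boldsymbol{\mathcal Z}$ is $\mathcal A_0$-orthogonal, that is, $$\mathcal A_0(\boldsymbol v,\boldsymbol z)=\mathcal A_0(\boldsymbol z,\boldsymbol v)=0\qquad\forall\,\boldsymbol v\in\boldsymbol V^{CR},\ \forall\,\boldsymbol z\in\boldsymbol{\mathcal Z}.$$
   Context: $\Omega\subset\mathbb R^d$, $d\in\{2,3\}$, is a polygon/polyhedron, $\partial\Omega=\Gamma_D\cup\Gamma_N$ (either part may be empty). $\mathcal T_h$ is a conforming (no hanging nodes) partition of $\Omega$ into simplices $T$. $\mathcal E_h^o$ is the set of interior faces ($(d-1)$-dimensional simplices); each boundary face belongs either to the set $\mathcal E_h^D$ of faces on $\Gamma_D$ or to the set $\mathcal E_h^N$ of faces on $\Gamma_N$. $h_E$ is the diameter of the face $E$. Each face $E$ carries a fixed unit normal $\boldsymbol n$ (outward to $\Omega$ on boundary faces); for interior $E$, $T^+$ (resp. $T^-$) is the neighbor for which $\boldsymbol n$ is outward (resp. inward). On interior faces $\{\!\{w\}\!\}=(w^++w^-)/2$ and $[\![w]\!]=w^+-w^-$, with $w^\pm$ the traces from $T^\pm$; on boundary faces $\{\!\{w\}\!\}=[\![w]\!]=w$. $\mathcal P_E^0 w=\frac1{|E|}\int_E w$ is the $L^2(E)$-projection onto constants (componentwise for vectors). $\boldsymbol V^{DG}$ is the space of vector fields in $[L^2(\Omega)]^d$ whose restriction to each $T\in\mathcal T_h$ lies in $[\mathbb P^1(T)]^d$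 (affine). Put $$\boldsymbol V^{CR}=\{\boldsymbol v\in\boldsymbol V^{DG}:\mathcal P^0_E[\![\boldsymbol v]\!]=0\ \ \forall E\in\mathcal E_h^o\cup\mathcal E_h^D\},\qquad \boldsymbol{\mathcal Z}=\{\boldsymbol z\in\boldsymbol V^{DG}:\mathcal P^0_E\{\!\{\boldsymbol z\}\!\}=0\ \ \forall E\in\mathcal E_h^o\cup\mathcal E_h^N\}.$$ $\mu>0$ and $\lambda\ge0$ are the (constant) Lamé parameters, $\mathcal C A=2\mu A+\lambda\,\mathrm{trace}(A)I$ for symmetric $A$, $\boldsymbol\varepsilon(\boldsymbol u)=\frac12(\nabla\boldsymbol u+(\nabla\boldsymbol u)^T)$ (elementwise), $\beta_0=d\lambda+2\mu$, $\alpha_0>0$ is a penalty parameter. With $\langle\cdot:\cdot\rangle$ the Frobenius product, $$\mathcal A_0(\boldsymbol u,\boldsymbol w)=\sum_{T}\int_T\langle\mathcal C\boldsymbol\varepsilon(\boldsymbol u):\boldsymbol\varepsilon(\boldsymbol w)\rangle-\sum_{E\in\mathcal E_h^o\cup\mathcal E_h^D}\int_E\Big(\langle\{\!\{(\mathcal C\boldsymbol\varepsilon(\boldsymbol u))\boldsymbol n\}\!\},[\![\boldsymbol w]\!]\rangle+\langle[\![\boldsymbol u]\!],\{\!\{(\mathcal C\boldsymbol\varepsilon(\boldsymbol w))\boldsymbol n\}\!\}\rangle\Big)+\alpha_0\beta_0\sum_{E\in\mathcal E_h^o\cup\mathcal E_h^D}h_E^{-1}\int_E\langle[\![\boldsymbol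 u]\!],\mathcal P_E^0[\![\boldsymbol w]\!]\rangle.$$ *)

(* Defs.v *)
From HB Require Import structures.
From mathcomp Require Import all_boot all_order all_algebra.
From mathcomp Require Import all_classical all_reals all_analysis.

Set Implicit Arguments.
Unset Strict Implicit.
Unset Printing Implicit Defensive.

Import Order.TTheory GRing.Theory Num.Theory.
Import numFieldNormedType.Exports.

Local Open Scope classical_set_scope.
Local Open Scope ring_scope.

Section Euclidean.
Context {R : realType} {d : nat}.
Implicit Types (x y : 'cV[R]_d) (A B : 'M[R]_d) (q : 'cV[R]_d -> 'cV[R]_d).

Definition dot x y : R := \sum_i x i 0 * y i 0.

Definition enorm x : R := Num.sqrt (dot x x).

Definition diam (A : set 'cV[R]_d) : R :=
  sup [set r | exists x y, [/\ A x, A y & r = enorm (x - y)]].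

Definition frob A B : R := \sum_i \sum_j A i j * B i j.

Definition P1 q : Prop :=
  exists (A : 'M[R]_d) (b : 'cV[R]_d), forall x, q x = A *m x + b.

Definition grad q x : 'M[R]_d :=
  \matrix_(i, j) ('D_(delta_mx j 0) q x) i 0.

Definition strain q x : 'M[R]_d := 2^-1 *: (grad q x + (grad q x)^T).

Definition hooke (mu lambda : R) A : 'M[R]_d :=
  (2 * mu) *: A + (lambda * \tr A)%:M.

(* Iterated integral of f over the set of all x + \sum_k t_k *: es_k with
   t_k >= 0 and \sum_k t_k <= s, with respect to the parameters t_k. *)
Fixpoint param_int (es : seq 'cV[R]_d) (s : R) x (f : 'cV[R]_d -> R) : R :=
  if es is e :: es' then
    \int[lebesgue_measure]_(t in `[0, s]) param_int es' (s - t) (x + t *: e) f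
  else f x.

Definition gram (es : seq 'cV[R]_d) : 'M[R]_(size es) :=
  \matrix_(i, j) dot es`_i es`_j.

End Euclidean.

Section Simplices.
Context {R : realType} {d : nat} {V : finType}.
Variable pt : V -> 'cV[R]_d.
Implicit Types (S : {set V}) (f : 'cV[R]_d -> R) (g : 'cV[R]_d -> 'cV[R]_d).

Definition affinely_independent S : Prop :=
  forall c : V -> R, \sum_(i in S) c i = 0 -> \sum_(i in S) c i *: pt i = 0 ->
    forall i, i \in S -> c i = 0.

Definition simplex S : set 'cV[R]_d :=
  [set x | exists c : V -> R, [/\ forall i, i \in S -> 0 <= c i,
     \sum_(i in S) c i = 1 & x = \sum_(i in S) c i *: pt i]].

(* The relative interior of [simplex S], for affinely independent S. *)
Definition open_simplex S : set 'cV[R]_d :=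
  [set x | exists c : V -> R, [/\ forall i, i \in S -> 0 < c i,
     \sum_(i in S) c i = 1 & x = \sum_(i in S) c i *: pt i]].

(* Integral over the simplex S with respect to the (#|S| - 1)-dimensional
   surface measure, through the affine parametrization of S by the reference
   simplex. The factor sqrt (det (J^T J)) is the area element of the
   parametrization; it is |det J| when #|S| = d + 1. *)
Definition integral_simplex S f : R :=
  if [seq pt i | i <- enum S] is a :: bs then
    let es := [seq b - a | b <- bs] in
    Num.sqrt (\det (gram es)) * param_int es 1 a f
  else 0.

Definition mean S g : 'cV[R]_d :=
  (integral_simplex S (fun=> 1))^-1 *:
    \col_i integral_simplex S (fun x => g x i 0).

Definition outward S (n : 'cV[R]_d) (T : {set V}) : Prop :=
  forall x y, simplex T x -> simplex S y -> dot n (x - y) <= 0.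

End Simplices.

Definition faces_of (d : nat) {V : finType} (cells : {set {set V}}) :
    {set {set V}} :=
  [set E : {set V} | (#|E| == d) && [exists T in cells, E \subset T]]%SET.

Definition boundary {T : topologicalType} (A : set T) : set T :=
  closure A `\` interior A.

(* A conforming simplicial partition [cells] of the domain [Omega], together
   with the splitting of the boundary and the choice of the face normals.
   Simplices and faces are given by their sets of vertices. *)
Record mesh (R : realType) (d : nat) := Mesh {
  Omega : set 'cV[R]_d ;
  GammaD : set 'cV[R]_d ;
  GammaN : set 'cV[R]_d ;
  vertex : finType ;
  pt : vertex -> 'cV[R]_d ;
  cells : {set {set vertex}} ;
  normal : {set vertex} -> 'cV[R]_d ;
  (* Open, and lying on one side only of its boundary (no slits). *)
  Omega_regular : interior (closure Omega) = Omega ;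
  boundaryE : GammaD `|` GammaN = boundary Omega ;
  card_cell : forall T, T \in cells -> #|T| = d.+1 ;
  cell_independent : forall T, T \in cells -> affinely_independent pt T ;
  cells_cover : closure Omega = \bigcup_(T in [set` cells]) simplex pt T ;
  (* No hanging nodes; it follows that cells have disjoint interiors. *)
  cells_conforming : forall T T', T \in cells -> T' \in cells ->
    simplex pt T `&` simplex pt T' = simplex pt (T :&: T')%SET ;
  (* Relative interiors of faces are used so that GammaD and GammaN may be
     either disjoint or closed with a common relative boundary. *)
  boundary_faces_split : forall E, E \in faces_of d cells ->
    simplex pt E `<=` boundary Omega ->
    (open_simplex pt E `<=` GammaD \/ open_simplex pt E `<=` GammaN) /\
    ~ (open_simplex pt E `<=` GammaD /\ open_simplex pt E `<=` GammaN) ;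
  normal_unit : forall E, E \in faces_of d cells -> enorm (normal E) = 1 ;
  normal_orthogonal : forall E, E \in faces_of d cells ->
    forall i j, i \in E -> j \in E -> dot (normal E) (pt i - pt j) = 0 ;
  normal_outward : forall E, E \in faces_of d cells ->
    simplex pt E `<=` boundary Omega ->
    forall T, T \in cells -> E \subset T -> outward pt E (normal E) T
}.

Arguments pt {R d} M _ : rename.
Arguments normal {R d} M _ : rename.

Section DG.
Context {R : realType} {d : nat}.
Variable M : mesh R d.
Local Notation face := {set vertex M}.
Local Notation field := ('cV[R]_d -> 'cV[R]_d).
Implicit Types (E T : face) (u v w z : field) (g : {set vertex M} -> field).

Definition faces : {set {set vertex M}} := faces_of d (cells M).

Definition boundary_face E : bool :=
  (E \in faces) && `[< simplex (pt M) E `<=` boundary (Omega M) >].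

Definition interior_face E : bool := (E \in faces) && ~~ boundary_face E.

Definition dirichlet_face E : bool :=
  boundary_face E && `[< open_simplex (pt M) E `<=` GammaD M >].

Definition neumann_face E : bool :=
  boundary_face E && `[< open_simplex (pt M) E `<=` GammaN M >].

(* On a boundary face, [cell_plus] is the only cell containing the face. *)
Definition cell_plus E : {set vertex M} :=
  odflt finset.set0 [pick T in cells M | (E \subset T) &&
                      `[< outward (pt M) E (normal M E) T >]].

Definition cell_minus E : {set vertex M} :=
  odflt finset.set0 [pick T in cells M | (E \subset T) &&
                      `[< outward (pt M) E (- normal M E) T >]].

(* [g T] is the restriction to the cell T of a piecewise smooth field,
   extended to the faces of T. *)
Definition jump E g : field := fun x =>
  if interior_face E then g (cell_plus E) x - g (cell_minus E) x
  else g (cell_plus E) x.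

Definition average E g : field := fun x =>
  if interior_face E then 2^-1 *: (g (cell_plus E) x + g (cell_minus E) x)
  else g (cell_plus E) x.

Definition P0 E (h : field) : 'cV[R]_d := mean (pt M) E h.

(* Equality almost everywhere in Omega of piecewise continuous fields. *)
Definition dg_eq u v : Prop :=
  forall T, T \in cells M ->
    forall x, open_simplex (pt M) T x -> u x = v x.

(* Such fields are bounded on the bounded set Omega, hence in L^2; their values
   on the skeleton, which is negligible, are irrelevant. *)
Definition VDG u : Prop :=
  forall T, T \in cells M -> exists2 q, P1 q &
    forall x, open_simplex (pt M) T x -> u x = q x.

(* The affine field on R^d which coincides with u in the cell T; it yields the
   traces of u on the faces of T. *)
Definition restr u T : field :=
  xget (fun=> 0) [set q : field | P1 q /\
    forall x, open_simplex (pt M) T x -> u x = q x].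

Definition VCR v : Prop :=
  VDG v /\ forall E, interior_face E || dirichlet_face E ->
    P0 E (jump E (restr v)) = 0.

Definition VZ z : Prop :=
  VDG z /\ forall E, interior_face E || neumann_face E ->
    P0 E (average E (restr z)) = 0.

Section Form.
Variables (mu lambda alpha0 : R).

Definition stress u T x : 'M[R]_d := hooke mu lambda (strain (restr u T) x).

Definition traction u E T : field := fun x => stress u T x *m normal M E.

Definition beta0 : R := d%:R * lambda + 2 * mu.

Definition A0 u w : R :=
  \sum_(T in cells M) integral_simplex (pt M) T (fun x =>
      frob (stress u T x) (strain (restr w T) x))
  - \sum_(E in faces | interior_face E || dirichlet_face E)
      integral_simplex (pt M) E (fun x =>
        dot (average E (traction u E) x) (jump E (restr w) x)
        + dot (jump E (restr u) x) (average E (traction w E) x))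
  + alpha0 * beta0 *
    \sum_(E in faces | interior_face E || dirichlet_face E)
      (diam (simplex (pt M) E))^-1 *
      integral_simplex (pt M) E (fun x =>
        dot (jump E (restr u) x) (P0 E (jump E (restr w)))).

End Form.
End DG.

(* Main.v *)
(* Affine functions are integrated over a simplex by evaluation
   at its barycenter, so every mean over a face E is a value at the
   barycenter of E, and an affine field on a cell T is determined by its
   values at the barycenters of the d + 1 faces of T, which may be prescribed
   arbitrarily. Conformity implies that an interior face has exactly one cell
   on each side and a boundary face exactly one cell. Hence u = v + z is
   solved face by face: on an interior face v takes the average of the two
   traces of u, on a Dirichlet face 0, on a Neumann face the trace of u, and
   a field in both spaces vanishes at all the face barycenters.

   For the orthogonality, the constant stress of v makes the volume term of
   A0 a sum of face terms: the outward area vector of the face of T opposite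
   to the vertex a is -d |T| grad lambda_a, where lambda_a is the barycentric
   coordinate, so the divergence theorem for affine fields on T is the linear
   part of the identity x = \sum_a lambda_a(x) a. Since z has zero mean
   averages, only the products of averaged tractions with jumps of z remain,
   and they cancel the consistency term; all the other terms contain a mean
   jump of v. *)
Require Import Defs.
From mathcomp Require Import all_boot all_order all_algebra perm.
From mathcomp Require Import all_classical all_reals all_analysis.
From mathcomp Require Import ring lra.
Set Implicit Arguments.
Unset Strict Implicit.
Unset Printing Implicit Defensive.
Import Order.TTheory GRing.Theory Num.Theory.
Import numFieldNormedType.Exports.
Local Open Scope classical_set_scope.
Local Open Scope ring_scope.

(** * Integration of affine functions *)

Section Integration.
Context {R : realType}.

(** The nested integrals of [param_int] are evaluated through explicit polynomial antiderivatives.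
    The interval reduced to a point is treated apart because [continuous_FTC2] asks for a
    nondegenerate one. *)
Lemma Rintegral_deriv_poly (p : {poly R}) (s : R) : 0 <= s ->
  \int[lebesgue_measure]_(t in `[0, s]) p^`().[t] = p.[s] - p.[0].
Proof.
rewrite le_eqVlt => /predU1P[<-|s0].
  by rewrite set_itv1 Rintegral_set1 subrr.
rewrite /Rintegral (@continuous_FTC2 _ _ (horner p)) ?EFinN //=.
- apply: continuous_subspaceT; exact: continuous_horner.
- split.
  + by move=> x _; apply: ex_derive.
  + apply: cvg_at_right_filter; exact: continuous_horner.
  + apply: cvg_at_left_filter; exact: continuous_horner.
- by move=> x _; rewrite derive1E; apply: derive_val.
Qed.

Context {d : nat}.
Implicit Types (x y z : 'cV[R]_d) (es : seq 'cV[R]_d).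

Lemma dotC x y : dot x y = dot y x.
Proof. by apply: eq_bigr => i _; rewrite mulrC. Qed.

Lemma dotDr x y z : dot x (y + z) = dot x y + dot x z.
Proof. by rewrite -big_split; apply: eq_bigr => i _; rewrite mxE mulrDr. Qed.

Lemma dotZr x a y : dot x (a *: y) = a * dot x y.
Proof. by rewrite mulr_sumr; apply: eq_bigr => i _; rewrite mxE mulrCA. Qed.

Lemma dot0r x : dot x 0 = 0.
Proof. by rewrite -(scale0r 0) dotZr mul0r. Qed.

Lemma dotNr x y : dot x (- y) = - dot x y.
Proof. by rewrite -scaleN1r dotZr mulN1r. Qed.

Lemma dotBr x y z : dot x (y - z) = dot x y - dot x z.
Proof. by rewrite dotDr dotNr. Qed.

Lemma dot_sumr x (I : Type) (r : seq I) (P : pred I) (F : I -> 'cV[R]_d) :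
  dot x (\sum_(i <- r | P i) F i) = \sum_(i <- r | P i) dot x (F i).
Proof.
by apply: (big_morph (dot x)) => [y z|]; rewrite ?dotDr ?dot0r.
Qed.

Lemma dotZl a x y : dot (a *: x) y = a * dot x y.
Proof. by rewrite dotC dotZr dotC. Qed.

Lemma dotDl x y z : dot (x + y) z = dot x z + dot y z.
Proof. by rewrite dotC dotDr !(dotC z). Qed.

Lemma dotNl x y : dot (- x) y = - dot x y.
Proof. by rewrite dotC dotNr dotC. Qed.

Lemma dot0l x : dot 0 x = 0.
Proof. by rewrite dotC dot0r. Qed.

Lemma dot_suml x (I : Type) (r : seq I) (P : pred I) (F : I -> 'cV[R]_d) :
  dot (\sum_(i <- r | P i) F i) x = \sum_(i <- r | P i) dot (F i) x.
Proof. by rewrite dotC dot_sumr; apply: eq_bigr => i _; rewrite dotC. Qed.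

Lemma dot_delta x j : dot x (delta_mx j 0) = x j 0.
Proof.
rewrite /dot (bigD1 j) //= mxE !eqxx mulr1 big1 ?addr0 // => i /negPf ij.
by rewrite mxE ij mulr0.
Qed.

Lemma dot_inj x y : (forall z, dot x z = dot y z) -> x = y.
Proof. by move=> xy; apply/colP => j; rewrite -!dot_delta xy. Qed.

Lemma dotxx_eq0 x : dot x x = 0 -> x = 0.
Proof.
move=> /eqP; rewrite psumr_eq0 => [|i _]; last by rewrite -expr2 sqr_ge0.
by move=> /allP x0; apply/colP => i; have := x0 i (mem_index_enum _);
  rewrite mulf_eq0 orbb mxE => /eqP.
Qed.

(** Induction on the m edges: a simplex of size s has parameter volume s^m / m! and first moments
    s^(m+1) / (m+1)!. Size and base point stay general because each integration replaces them by s -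
    t and x + t e. *)
Lemma param_int_affine es (s : R) x (l : 'cV[R]_d) (c : R) : 0 <= s ->
  param_int es s x (fun y => dot l y + c) =
  (size es)`!%:R^-1 * s ^+ size es * (dot l x + c)
  + (size es).+1`!%:R^-1 * s ^+ (size es).+1 * \sum_(e <- es) dot l e.
Proof.
elim: es s x => [|e es IH] s x s0 /=.
  by rewrite big_nil mulr0 addr0 fact0 invr1 expr0 !mul1r.
rewrite big_cons; set m := size es; set C := \sum_(_ <- _) _.
set A := dot l x + c; set B := dot l e.
pose S : {poly R} := s%:P - 'X.
(* Antiderivative found by parts: the first term contributes S^m (A + B X) / m! and a remainder - B
   S^(m+1) / (m+1)!, which the B of the second term cancels. *)
pose p : {poly R} := - (m.+1`!%:R^-1 *: (S ^+ m.+1 * (A%:P + B *: 'X)))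
   - (m.+2`!%:R^-1 * (B + C)) *: S ^+ m.+2.
transitivity (\int[lebesgue_measure]_(t in `[0, s]) p^`().[t]).
  apply: eq_Rintegral => t; rewrite inE /= in_itv /= => /andP[t0 ts].
  rewrite IH ?subr_ge0 // -/m -/C dotDr dotZr -/B addrAC -/A.
  have dS k : (S ^+ k.+1)^`() = - (k.+1%:R *: S ^+ k).
    by rewrite deriv_exp /S derivB derivC derivX sub0r mulN1r mulNrn scaler_nat.
  have fE k : k.+1`!%:R^-1 * k.+1%:R = k`!%:R^-1 :> R.
    by rewrite factS natrM invfM mulrAC mulVf ?mul1r // pnatr_eq0.
  have hS k : (S ^+ k).[t] = (s - t) ^+ k by rewrite horner_exp /S !hornerE.
  rewrite /p -(fE m).
  (* Factorials and powers become variables, so that [ring] meets no symbolic exponent. *)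
  move: (fE m.+1) (dS m) (dS m.+1) (hS m) (hS m.+1) (hS m.+2).
  move: (m.+2`!%:R^-1) ((s - t) ^+ m) ((s - t) ^+ m.+1) ((s - t) ^+ m.+2).
  move: (S ^+ m) (S ^+ m.+1) (S ^+ m.+2) (m.+1`!%:R^-1) => S0 S1 S2 b a X Y Z.
  move=> bE dS1 dS2 h0 h1 h2.
  rewrite derivB derivN !derivZ derivM dS1 dS2 derivD derivC derivZ derivX.
  rewrite !(hornerE, horner_exp) h0 h1 -bE.
  move: (m.+2%:R) (m.+1%:R) => b' k.
  by rewrite /=; ring.
have hS k (y : R) : (S ^+ k).[y] = (s - y) ^+ k by rewrite horner_exp /S !hornerE.
rewrite Rintegral_deriv_poly // /p.
move: (hS m.+1 s) (hS m.+2 s) (hS m.+1 0) (hS m.+2 0).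
rewrite subrr subr0 !expr0n /=.
move: (s ^+ m.+1) (s ^+ m.+2) (S ^+ m.+1) (S ^+ m.+2) => X Y S1 S2 h1 h2 h3 h4.
rewrite !hornerE /= h1 h2 h3 h4.
by ring.
Qed.

End Integration.

(** * Simplices and their volumes *)

Section Simplex.
Context {R : realType} {d : nat} {V : finType}.
Variable pt : V -> 'cV[R]_d.
Implicit Types (S T : {set V}) (es : seq 'cV[R]_d) (x : 'cV[R]_d).

Definition area S : R := integral_simplex pt S (fun=> 1).

Definition bary S : 'cV[R]_d := #|S|%:R^-1 *: \sum_(i in S) pt i.

Lemma param_int1 es x : param_int es 1 x (fun=> 1) = (size es)`!%:R^-1 :> R.
Proof.
have -> : (fun=> 1) = (fun y : 'cV[R]_d => dot 0 y + 1).
  by apply/funext => y; rewrite dot0l add0r.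
rewrite param_int_affine ?ler01 // !expr1n dot0l add0r !mulr1.
by rewrite big1 ?mulr0 ?addr0 // => e _; rewrite dot0l.
Qed.

(** At s = 1, the ratio of the two factorials in [param_int_affine] divides the sum of the edges by
    the number of vertices, which moves the base vertex to the barycenter. *)
Lemma integral_simplex_affine S (l : 'cV[R]_d) (c : R) : S != finset.set0 ->
  integral_simplex pt S (fun x => dot l x + c) = area S * (dot l (bary S) + c).
Proof.
move=> S0; rewrite /area /integral_simplex.
have : size (enum S) = #|S| by rewrite -cardE.
have : \sum_(i in S) pt i = \sum_(p <- [seq pt i | i <- enum S]) p.
  by rewrite big_map big_enum.
rewrite -card_gt0 in S0; rewrite /bary.
case: (enum S) => [_ /= S0'|i s /= -> sS]; first by rewrite -S0' in S0.
rewrite param_int1 param_int_affine ?ler01 // !expr1n !mulr1 -mulrA.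
congr (_ * _); rewrite !size_map -sS !big_map big_cons big_map dotZr dotDr.
rewrite dot_sumr.
under eq_bigr do rewrite dotBr.
rewrite sumrB big_const_seq count_predT iter_addr addr0.
rewrite factS natrM invfM -[dot _ _ *+ _]mulr_natl.
move: (dot l (pt i)) (\sum_(_ <- _) _) => u w.
have m1 : (size s).+1%:R != 0 :> R by rewrite pnatr_eq0.
have -> : (size s)%:R = (size s).+1%:R - 1 :> R by rewrite -natr1 addrK.
move: ((size s)`!%:R^-1) (_.+1%:R) m1 => f m m1.
by field.
Qed.

Lemma big_enum_nth (A : nmodType) (F : V -> A) S (n : nat) (x0 : V) : #|S| = n ->
  \sum_(i in S) F i = \sum_(j < n) F (nth x0 (enum S) j).
Proof. by move=> <-; rewrite -big_enum (big_nth x0) -cardE big_mkord. Qed.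

(** Passage to matrix indices: a vertex is weighted through its position in [enum S], which is well
    defined because the enumeration is duplicate-free. *)
Lemma affinely_independent_nth S (x0 : V) (v : nat -> R) :
  affinely_independent pt S -> \sum_(j < #|S|) v j = 0 ->
  \sum_(j < #|S|) v j *: pt (nth x0 (enum S) j) = 0 ->
  forall j, (j < #|S|)%N -> v j = 0.
Proof.
move=> iS v0 v1 j jS.
have vE k : (k < #|S|)%N -> v (index (nth x0 (enum S) k) (enum S)) = v k.
  by move=> kS; rewrite index_uniq ?enum_uniq // -cardE.
rewrite -(vE j) //; apply: (iS (fun i => v (index i (enum S)))).
- rewrite (big_enum_nth _ x0 (erefl _)) -[RHS]v0.
  by apply: eq_bigr => k _; rewrite vE.
- rewrite (big_enum_nth _ x0 (erefl _)) -[RHS]v1.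
  by apply: eq_bigr => k _; rewrite vE.
- by rewrite -mem_enum mem_nth // -cardE.
Qed.

Lemma sum_sub (A : nmodType) (F : V -> A) S T : S \subset T ->
  \sum_(j in S) F j = \sum_(j in T) if j \in S then F j else 0.
Proof.
move=> ST; rewrite -big_mkcondr; apply: eq_bigl => j.
by case: (boolP (j \in S)) => [/(fintype.subsetP ST) ->|]; rewrite ?andbF.
Qed.

Lemma affinely_independent_sub S T :
  S \subset T -> affinely_independent pt T -> affinely_independent pt S.
Proof.
move=> ST iT c c0 c1 i iS.
have := iT (fun j => if j \in S then c j else 0) _ _ i (fintype.subsetP ST i iS).
rewrite iS; apply; first by rewrite -(sum_sub _ ST).
rewrite (sum_sub _ ST) in c1; rewrite -[RHS]c1; apply: eq_bigr => j _.
by case: ifP; rewrite ?scale0r.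
Qed.

(** The number of rows is an argument rather than [size es], so that square matrices of a prescribed
    dimension need no casts. *)
Definition rows (m : nat) es : 'M[R]_(m, d) := \matrix_(i, j) es`_i j 0.

Lemma det_gram (m : nat) es :
  size es = m -> \det (gram es) = \det (rows m es *m (rows m es)^T).
Proof.
move=> <-; congr (\det _); apply/matrixP => i j; rewrite !mxE.
by apply: eq_bigr => k _; rewrite !mxE.
Qed.

(* The rows (1, p_i): up to sign its determinant does not depend on the
   enumeration of the vertices, and it is that of the edges from any of them. *)
Definition homogeneous es : 'M[R]_(1 + d) :=
  row_mx (const_mx 1) (rows (1 + d) es).

(** Subtracting the first row from the others, through the unipotent matrix [U], leaves a block
    triangular matrix whose last block holds the edges from x. *)
Lemma det_homogeneous x es : size es = d ->
  \det (homogeneous (x :: es)) = \det (rows d [seq y - x | y <- es]).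
Proof.
move=> es_d.
have -> : homogeneous (x :: es) =
    block_mx (const_mx 1 : 'M[R]_1) x^T (const_mx 1) (rows d es).
  rewrite block_mxEh /homogeneous; congr row_mx.
    by apply/matrixP => i j; rewrite !mxE; case: splitP => k _; rewrite mxE.
  apply/matrixP => i j; rewrite !mxE; case: splitP => k ik.
    by rewrite ik (ord1 k) mxE.
  by rewrite ik mxE.
pose U : 'M[R]_(1 + d) := block_mx 1%:M 0 (const_mx (- 1)) 1%:M.
have <- : \det (U *m block_mx (const_mx 1 : 'M[R]_1) x^T (const_mx 1) (rows d es))
   = \det (block_mx (const_mx 1 : 'M[R]_1) x^T (const_mx 1) (rows d es)).
  by rewrite det_mulmx det_lblock !det1 !mul1r.
rewrite mulmx_block !mul1mx !mul0mx !addr0.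
have -> : const_mx (-1) *m (const_mx 1 : 'M[R]_1) + const_mx 1 = 0 :> 'M[R]_(d, 1).
  by apply/colP => i; rewrite !mxE big_ord1 !mxE; lra.
rewrite det_ublock det_mx11 mxE mul1r; congr (\det _).
apply/matrixP => i j; rewrite !mxE big_ord1 !mxE (nth_map 0) ?es_d // !mxE.
by rewrite mulN1r addrC.
Qed.

Lemma norm_det_homogeneous_perm es es' : size es = d.+1 -> perm_eq es es' ->
  `|\det (homogeneous es)| = `|\det (homogeneous es')|.
Proof.
move=> sz ees'; have sz' : size es' == d.+1 by rewrite -(perm_size ees') sz.
have /tuple_permP[p eq_es] : perm_eq es (Tuple sz') by [].
have -> : homogeneous es = row_perm p (homogeneous es').
  apply/matrixP => i j; rewrite !mxE; case: splitP => k _; rewrite !mxE //.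
  by rewrite eq_es -tnth_nth tnth_mktuple (tnth_nth 0).
by rewrite row_permE det_mulmx det_perm normrM normrX normrN1 expr1n mul1r.
Qed.

(** A row vector in the left kernel is an affine dependence: the column of ones says that its
    weights sum to 0, the other columns that the weighted vertices do. *)
Lemma homogeneous_unit T : affinely_independent pt T -> #|T| = d.+1 ->
  homogeneous [seq pt i | i <- enum T] \in unitmx.
Proof.
move=> iT cT; rewrite -row_free_unit; apply: inj_row_free => v vH.
have /card_gt0P[x0 _] : (0 < #|T|)%N by rewrite cT.
have szT : size (enum T) = d.+1 by rewrite -cardE.
pose w (j : nat) := if insub j is Some o then v 0 o else 0.
have wE (j : 'I_(1 + d)) : w j = v 0 j by rewrite /w valK.
apply/rowP => j; rewrite -wE mxE; move: j vH => [j jd] vH /=.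
apply: (affinely_independent_nth (x0 := x0) iT); rewrite cT //.
  have /rowP/(_ (lshift d 0)) := vH; rewrite mxE [RHS]mxE => vl.
  by rewrite -[RHS]vl; apply: eq_bigr => k _; rewrite wE row_mxEl [X in _ * X]mxE mulr1.
apply/colP => l; have /rowP/(_ (rshift 1 l)) := vH; rewrite mxE [RHS]mxE => vl.
rewrite [RHS]mxE -[RHS]vl summxE; apply: eq_bigr => k _; rewrite wE row_mxEr !mxE.
by rewrite (nth_map x0) ?szT.
Qed.

(** The coordinates of x are the row (1, x^T) times the inverse of the homogeneous matrix.
    Multiplying back by that matrix gives both identities, one from the column of ones and one from
    the columns of vertices. *)
Lemma barycentric_coordinates T : affinely_independent pt T -> #|T| = d.+1 ->
  exists (g : V -> 'cV[R]_d) (k : V -> R), forall x,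
    \sum_(i in T) (dot (g i) x + k i) = 1 /\
    \sum_(i in T) (dot (g i) x + k i) *: pt i = x.
Proof.
move=> iT cT; set H := homogeneous [seq pt i | i <- enum T].
have HK : H \in unitmx by exact: homogeneous_unit.
have /card_gt0P[x0 _] : (0 < #|T|)%N by rewrite cT.
have szT : size (enum T) = d.+1 by rewrite -cardE.
pose o i : 'I_(1 + d) := inord (index i (enum T)).
have oE (j : 'I_(1 + d)) : o (nth x0 (enum T) j) = j.
  by rewrite /o index_uniq ?enum_uniq ?szT // inord_val.
exists (fun i => \col_l invmx H (rshift 1 l) (o i)).
exists (fun i => invmx H (lshift d 0) (o i)) => x.
pose r : 'rV[R]_(1 + d) := row_mx (const_mx 1) x^T.
have cE (j : 'I_(1 + d)) : dot (\col_l invmx H (rshift 1 l) j) x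
    + invmx H (lshift d 0) j = (r *m invmx H) 0 j.
  rewrite mxE big_split_ord big_ord1 row_mxEl mxE mul1r addrC; congr (_ + _).
  by apply: eq_bigr => l _; rewrite row_mxEr !mxE mulrC.
have rH : r *m invmx H *m H = r by rewrite mulmxKV.
split.
  rewrite (big_enum_nth _ x0 cT).
  have /rowP/(_ (lshift d 0)) := rH; rewrite [RHS]row_mxEl mxE [in RHS]mxE => <-.
  by apply: eq_bigr => j _; rewrite oE cE row_mxEl [X in _ * X]mxE mulr1.
rewrite (big_enum_nth _ x0 cT); apply/colP => l.
have /rowP/(_ (rshift 1 l)) := rH; rewrite [RHS]row_mxEr mxE [in RHS]mxE => <-.
rewrite summxE; apply: eq_bigr => j _; rewrite mxE oE cE row_mxEr; congr (_ * _).
by rewrite mxE (nth_map x0) ?szT.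
Qed.

End Simplex.

(** * Volume as base times height, through Gram determinants *)

Section Height.
Context {R : realType}.

Lemma mul_rows_tr (d m p : nat) (s t : seq 'cV[R]_d) i j :
  (rows m s *m (rows p t)^T) i j = dot s`_i t`_j.
Proof. by rewrite mxE; apply: eq_bigr => k _; rewrite !mxE. Qed.

(** The product of the first matrix with the transpose of the second is block triangular, because n
    is orthogonal to the edges [es]. *)
Lemma mul_rows_cons_normal (k : nat) (u n : 'cV[R]_k.+1) (es : seq 'cV[R]_k.+1) :
  size es = k -> (forall e, e \in es -> dot n e = 0) ->
  \det (rows k.+1 (u :: es)) * \det (rows k.+1 (n :: es)) =
  dot n u * \det (gram es).
Proof.
move=> sz n_es; rewrite (det_gram sz) -[\det (rows _ (n :: es))]det_tr -det_mulmx.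
pose N : 'M[R]_(1 + k) := block_mx (const_mx (dot n u)) (\row_j dot u es`_j)
  0 (rows k es *m (rows k es)^T).
have -> : rows k.+1 (u :: es) *m (rows k.+1 (n :: es))^T = N.
  apply/matrixP => i j; rewrite mul_rows_tr.
  rewrite -[N i j]/(block_mx _ _ _ _ (i : 'I_(1 + k)) (j : 'I_(1 + k))).
  rewrite [RHS]mxE; case: (@splitP 1 k i) => i' ->; rewrite mxE.
    by case: (@splitP 1 k j) => j' ->; rewrite mxE (ord1 i') ?(ord1 j') //= dotC.
  case: (@splitP 1 k j) => j' -> /=; last by rewrite mul_rows_tr.
  by rewrite (ord1 j') add0n [RHS]mxE dotC n_es // mem_nth ?sz.
have := det_ublock (const_mx (dot n u) : 'M[R]_1) (\row_j dot u es`_j)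
  (rows k es *m (rows k es)^T).
by rewrite det_mx11 mxE => <-.
Qed.

(** Taking u = n in the previous identity shows that the Gram determinant is the square of b; for
    general u, one factor b is then cancelled. *)
Lemma norm_det_rows_cons (k : nat) (u n : 'cV[R]_k.+1) (es : seq 'cV[R]_k.+1) :
  size es = k -> (forall e, e \in es -> dot n e = 0) -> dot n n = 1 ->
  \det (gram es) != 0 ->
  `|\det (rows k.+1 (u :: es))| = `|dot n u| * Num.sqrt (\det (gram es)) /\
  0 < \det (gram es).
Proof.
move=> sz n_es nn G0; set b := \det (rows k.+1 (n :: es)).
have bb : \det (gram es) = b ^+ 2.
  by rewrite -[LHS]mul1r -nn -mul_rows_cons_normal.
have b0 : b != 0 by apply: contraNneq G0 => b0; rewrite bb b0 expr0n.
split; last by rewrite bb exprn_even_gt0.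
rewrite bb sqrtr_sqr -normrM; congr (`|_|); apply: (mulIf b0).
by rewrite (mul_rows_cons_normal u sz n_es) bb -mulrA -expr2.
Qed.

End Height.

Section Area.
Context {R : realType} {d : nat} {V : finType}.
Variable pt : V -> 'cV[R]_d.
Implicit Types (S T : {set V}).

Lemma areaE S i s : enum S = i :: s ->
  area pt S = Num.sqrt (\det (gram [seq b - pt i | b <- [seq pt j | j <- s]]))
              * (size s)`!%:R^-1.
Proof.
rewrite /area /integral_simplex => -> /=; rewrite param_int1.
by congr (_ * _); rewrite !size_map.
Qed.

(** A kernel vector of the Gram matrix gives a combination z of the edges orthogonal to every edge,
    hence to itself. So z = 0, which is an affine dependence of the vertices. *)
Lemma det_gram_edges_neq0 S i s :
  affinely_independent pt S -> enum S = i :: s ->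
  \det (gram [seq b - pt i | b <- [seq pt j | j <- s]]) != 0.
Proof.
move=> iS eS; set es := [seq _ | _ <- _].
have szs : size es = size s by rewrite !size_map.
have cS : #|S| = (size s).+1 by rewrite cardE eS.
rewrite (det_gram szs) -unitfE -[_ \is a _]/(_ \in unitmx) -row_free_unit.
apply: inj_row_free => v vG.
have eE (j : 'I_(size s)) : es`_j = pt (nth i s j) - pt i.
  by rewrite /es -map_comp (nth_map i).
pose z := \sum_j v 0 j *: es`_j.
have z0 : z = 0.
  apply: dotxx_eq0; rewrite {2}/z dot_sumr big1 // => j _; rewrite dotZr.
  have /rowP/(_ j) := vG; rewrite mxE [RHS]mxE => vj.
  suff -> : dot z es`_j = 0 by rewrite mulr0.
  rewrite -[RHS]vj /z dot_suml; apply: eq_bigr => l _.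
  by rewrite dotZl mul_rows_tr.
(* The base vertex, first in the enumeration, receives the weight that makes the total vanish. *)
pose w (j : nat) := if j is j'.+1 then
  (if insub j' is Some o then v 0 o else 0) else - \sum_o v 0 o.
have wE (j : 'I_(size s)) : w j.+1 = v 0 j by rewrite /w valK.
apply/rowP => j; rewrite mxE -wE.
apply: (affinely_independent_nth (x0 := i) iS); rewrite ?cS ?ltnS //.
  by rewrite big_ord_recl; under eq_bigr do rewrite lift0 wE; rewrite addNr.
rewrite big_ord_recl eS; under eq_bigr do rewrite lift0 wE.
rewrite -[RHS]z0 /z; under [RHS]eq_bigr do rewrite eE scalerBr.
by rewrite sumrB -scaler_suml scaleNr /= addrC.
Qed.

End Area.

(** The volume of T is base times height divided by d: the factor d is the quotient of the
    factorials in the two reference volumes. Any vertex j of the face may serve, since n is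
    orthogonal to the face. *)
Lemma area_face (R : realType) (d : nat) (V : finType) (pt : V -> 'cV[R]_d)
    (T : {set V}) (a : V) (n : 'cV[R]_d) :
  (0 < d)%N -> affinely_independent pt T -> #|T| = d.+1 -> a \in T ->
  dot n n = 1 ->
  {in T :\ a & , forall i j, dot n (pt i - pt j) = 0} ->
  0 < area pt (T :\ a) /\
  forall j, j \in T :\ a ->
  `|dot n (pt a - pt j)| * area pt (T :\ a) = d%:R * area pt T.
Proof.
case: d pt n => // k pt n _ iT cT aT nn n_E.
have iE : affinely_independent pt (T :\ a).
  by apply: affinely_independent_sub iT; rewrite subD1set.
have cE : #|T :\ a| = k.+1 by have := cardsD1 a T; rewrite cT aT => -[].
case eE : (enum (T :\ a)) => [|i s]; first by rewrite cardE eE in cE.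
have szs : size s = k by move: cE; rewrite cardE eE => -[].
have mE x : (x \in i :: s) = (x != a) && (x \in T).
  by rewrite -eE mem_enum !inE.
set es := [seq b - pt i | b <- [seq pt j | j <- s]].
have szes : size es = k by rewrite !size_map.
have iT' : i \in T :\ a by rewrite in_setD1 -mE mem_head.
have n_es e : e \in es -> dot n e = 0.
  rewrite /es -map_comp => /mapP[j js ->] /=; apply: n_E => //.
  by rewrite in_setD1 -mE inE js orbT.
have [hE Gpos] := norm_det_rows_cons (pt a - pt i) szes n_es nn
  (det_gram_edges_neq0 iE eE).
have aE : area pt (T :\ a) = Num.sqrt (\det (gram es)) * k`!%:R^-1.
  by rewrite (areaE pt eE) szs.
have kf : k`!%:R != 0 :> R by rewrite pnatr_eq0 -lt0n fact_gt0.
split.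
  by rewrite aE mulr_gt0 ?sqrtr_gt0 // invr_gt0 ltr0n fact_gt0.
move=> j jE.
have -> : pt a - pt j = pt a - pt i + (pt i - pt j) by rewrite addrA subrK.
rewrite dotDr (n_E i j) // addr0 aE mulrA -hE.
case eT : (enum T) => [|i' s']; first by rewrite cardE eT in cT.
have szs' : size s' = k.+1 by move: cT; rewrite cardE eT => -[].
rewrite (areaE pt eT) szs'; set es' := [seq _ | _ <- _].
have szes' : size es' = k.+1 by rewrite !size_map.
rewrite (det_gram szes') det_mulmx det_tr -expr2 sqrtr_sqr /es'.
rewrite -det_homogeneous ?size_map // -map_cons -eT.
(* With the vertices reordered as i, a, s, the edges from i are the one to a, followed by those
   spanning the face. *)
rewrite (norm_det_homogeneous_perm (es' := [seq pt x | x <- [:: i, a & s]])).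
- rewrite det_homogeneous /=.
  rewrite factS natrM invfM [RHS]mulrCA [_%:R * (_ * _)]mulrA.
  by rewrite divff ?pnatr_eq0 // mul1r.
- by rewrite -[LHS]/(size (map pt s)).+1 size_map szs.
- by rewrite size_map -cardE.
apply/perm_map/uniq_perm; first exact: enum_uniq.
  have := enum_uniq (T :\ a); rewrite eE /= => /andP[i_s ->].
  rewrite inE negb_or i_s !andbT.
  have : a \notin i :: s by rewrite mE eqxx.
  by rewrite inE negb_or => /andP[ai ->]; rewrite eq_sym ai.
move=> x; rewrite mem_enum !inE.
case: (eqVneq x a) => [->|xa]; first by rewrite aT orbT.
by have := mE x; rewrite xa inE /= => <-.
Qed.

(** * Barycentric coordinates *)

Section Coordinates.
Context {R : realType} {d : nat} {V : finType}.
Variable pt : V -> 'cV[R]_d.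
Implicit Types (S T E : {set V}) (x n : 'cV[R]_d).

Lemma bary_sum S : bary pt S = \sum_(i in S) #|S|%:R^-1 *: pt i.
Proof. by rewrite /bary scaler_sumr. Qed.

Lemma sum_bary_weights S : S != finset.set0 ->
  \sum_(i in S) #|S|%:R^-1 = 1 :> R.
Proof.
by rewrite -card_gt0 => S0; rewrite sumr_const -[LHS]mulr_natr mulVf // pnatr_eq0 -lt0n.
Qed.

Lemma open_simplex_bary S : S != finset.set0 -> open_simplex pt S (bary pt S).
Proof.
move=> S0; exists (fun=> #|S|%:R^-1); split; last exact: bary_sum.
  by move=> i _; rewrite invr_gt0 ltr0n card_gt0.
exact: sum_bary_weights.
Qed.

Lemma open_simplexW S : open_simplex pt S `<=` simplex pt S.
Proof. by move=> x [c [c0 c1 xE]]; exists c; split=> // i /c0/ltW. Qed.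

Lemma simplex_sub S T : S \subset T -> simplex pt S `<=` simplex pt T.
Proof.
move=> ST x [c [c0 c1 xE]].
exists (fun i => if i \in S then c i else 0); split=> [i _||].
- by case: ifP => // /c0.
- by rewrite -(sum_sub _ ST).
- rewrite xE (sum_sub _ ST); apply: eq_bigr => i _.
  by case: ifP; rewrite ?scale0r.
Qed.

Lemma affinely_independent_inj T (c c' : V -> R) : affinely_independent pt T ->
  \sum_(i in T) c i = \sum_(i in T) c' i ->
  \sum_(i in T) c i *: pt i = \sum_(i in T) c' i *: pt i ->
  {in T, c =1 c'}.
Proof.
move=> iT e1 e2 i iT'; apply/eqP; rewrite -subr_eq0; apply/eqP.
apply: (iT (fun i => c i - c' i)) iT'; first by rewrite sumrB e1 subrr.
by under eq_bigr do rewrite scalerBl; rewrite sumrB e2 subrr.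
Qed.

(** [dot (g i) x + k i] is the barycentric coordinate lambda_i, kept as an affine function so that
    its gradient [g i] is available. *)
Definition is_barycentric T (g : V -> 'cV[R]_d) (k : V -> R) := forall x,
  \sum_(i in T) (dot (g i) x + k i) = 1 /\
  \sum_(i in T) (dot (g i) x + k i) *: pt i = x.

Section WithCoordinates.
Variables (T : {set V}) (g : V -> 'cV[R]_d) (k : V -> R).
Hypotheses (iT : affinely_independent pt T) (gk : is_barycentric T g k).

Lemma coord_combination (c : V -> R) i : i \in T -> \sum_(j in T) c j = 1 ->
  dot (g i) (\sum_(j in T) c j *: pt j) + k i = c i.
Proof.
move=> iiT c1; have [e1 e2] := gk (\sum_(j in T) c j *: pt j).
by apply: (affinely_independent_inj iT _ e2) iiT; rewrite e1 c1.
Qed.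

Lemma coord_sub S (c : V -> R) i : S \subset T -> i \in T ->
  \sum_(j in S) c j = 1 ->
  dot (g i) (\sum_(j in S) c j *: pt j) + k i = if i \in S then c i else 0.
Proof.
move=> ST iiT c1; pose c' i := if i \in S then c i else 0.
have -> : \sum_(j in S) c j *: pt j = \sum_(j in T) c' j *: pt j.
  rewrite (sum_sub _ ST); apply: eq_bigr => j _.
  by rewrite /c'; case: ifP; rewrite ?scale0r.
by rewrite coord_combination // -(sum_sub _ ST).
Qed.

Lemma coord_bary S i : S \subset T -> S != finset.set0 -> i \in T ->
  dot (g i) (bary pt S) + k i = if i \in S then #|S|%:R^-1 else 0.
Proof.
by move=> ST S0 iiT; rewrite bary_sum coord_sub // sum_bary_weights.
Qed.

Lemma coord_vertex i j : i \in T -> j \in T ->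
  dot (g i) (pt j) + k i = (i == j)%:R.
Proof.
move=> iiT jT; have := @coord_sub [set j]%SET (fun=> 1) i.
rewrite !big_set1 scale1r finset.in_set1 => ->; rewrite ?finset.sub1set //.
by case: eqP.
Qed.

Lemma simplex_coord S x i : S \subset T -> i \in T -> simplex pt S x ->
  0 <= dot (g i) x + k i /\ (i \notin S -> dot (g i) x + k i = 0).
Proof.
move=> ST iiT [c [c0 c1 ->]]; rewrite coord_sub //.
by case: ifP => // /c0.
Qed.

Lemma open_simplex_coord S x i : S \subset T -> i \in S -> open_simplex pt S x ->
  0 < dot (g i) x + k i.
Proof.
move=> ST iS [c [c0 c1 ->]]; rewrite coord_sub // ?iS ?c0 //.
exact: (fintype.subsetP ST).
Qed.

Lemma coord_simplex x : (forall i, i \in T -> 0 <= dot (g i) x + k i) ->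
  simplex pt T x.
Proof.
by move=> x0; have [e1 e2] := gk x; exists (fun i => dot (g i) x + k i); split.
Qed.

Lemma coord_open_simplex x : (forall i, i \in T -> 0 < dot (g i) x + k i) ->
  open_simplex pt T x.
Proof.
by move=> x0; have [e1 e2] := gk x; exists (fun i => dot (g i) x + k i); split.
Qed.

Lemma coord_line x y t i :
  dot (g i) (x + t *: (y - x)) + k i =
  (1 - t) * (dot (g i) x + k i) + t * (dot (g i) y + k i).
Proof. by rewrite dotDr dotZr dotBr; ring. Qed.

(** Linear part of the identity saying that the coordinates sum to 1. *)
Lemma sum_grad : \sum_(i in T) g i = 0.
Proof.
apply: dot_inj => x; rewrite dot0l dot_suml.
have [e1 _] := gk x; have [e0 _] := gk 0.
move: e1; rewrite big_split /= -[X in _ = X]e0 [in RHS]big_split /=.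
by rewrite [X in _ = X + _]big1 => [|i _]; rewrite ?dot0r // add0r => /eqP;
  rewrite -subr_eq0 addrK => /eqP.
Qed.

(** In matrix form, the sum of the p_i g_i^T is the identity. *)
Lemma sum_grad_pt x : \sum_(i in T) dot (g i) x *: pt i = x.
Proof.
have [_ ex] := gk x; have [_ e0] := gk 0.
transitivity (\sum_(i in T) (dot (g i) x + k i) *: pt i
  - \sum_(i in T) (dot (g i) 0 + k i) *: pt i); last by rewrite ex e0 subr0.
by rewrite -sumrB; apply: eq_bigr => i _; rewrite -scalerBl dot0r add0r addrK.
Qed.

Section Normal.
Variables (a : V) (n : 'cV[R]_d).
Hypotheses (aT : a \in T) (E0 : T :\ a != finset.set0).
Hypothesis n_E : {in T :\ a & , forall i j, dot n (pt i - pt j) = 0}.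

Lemma normal_vertex i : i \in T :\ a -> dot n (pt i - bary pt (T :\ a)) = 0.
Proof.
move=> iE.
rewrite -[pt i]scale1r -(sum_bary_weights E0) scaler_suml bary_sum -sumrB dot_sumr.
by rewrite big1 // => j jE; rewrite -scalerBr dotZr n_E ?mulr0.
Qed.

(** Expanding x in barycentric coordinates, every vertex of the face contributes 0 and only the
    opposite vertex a remains. *)
Lemma normal_coord x : dot n (x - bary pt (T :\ a)) =
  dot n (pt a - bary pt (T :\ a)) * (dot (g a) x + k a).
Proof.
have [e1 e2] := gk x; set b := bary pt _.
rewrite -[X in X - _]e2 -[b in LHS]scale1r -e1 scaler_suml -sumrB dot_sumr.
rewrite (bigD1 a) //= [X in _ + X]big1 => [|i /andP[iiT ia]].
  by rewrite addr0 -scalerBr dotZr mulrC.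
by rewrite -scalerBr dotZr normal_vertex ?mulr0 // in_setD1 ia.
Qed.

Lemma normal_grad : n = dot n (pt a - bary pt (T :\ a)) *: g a.
Proof.
apply: dot_inj => x; have := normal_coord x; have := normal_coord 0.
rewrite dotZl dot0r !add0r dotNr => e0.
by rewrite dotBr mulrDr -e0 => /addIr.
Qed.

End Normal.
End WithCoordinates.
End Coordinates.

(** * Cells around a face *)

Section Near.
Context {R : realType}.

Lemma near_affine_gt0 (u w : R) : 0 < u -> \forall t \near 0^'+, 0 < u + t * w.
Proof.
move=> u0; near=> t.
have t0 : 0 < t by near: t; exact: nbhs_right_gt.
have w1 : 0 < `|w| + 1 by rewrite ltr_wpDl.
(* Adding 1 keeps the denominator positive when w = 0. *)
have : t < u / (`|w| + 1) by near: t; apply: nbhs_right_lt; rewrite divr_gt0.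
rewrite ltr_pdivlMr // mulrDr mulr1 => tu.
have : - (t * `|w|) <= t * w.
  by rewrite -mulrN; apply: ler_wpM2l; [exact: ltW|rewrite lerNl -normrN ler_norm].
lra.
Unshelve. all: by end_near.
Qed.

Lemma near_line (d : nat) (A : set 'cV[R]_d) (x v : 'cV[R]_d) :
  nbhs x A -> \forall t \near 0^'+, A (x + t *: v).
Proof.
move=> xA; suff /(_ A xA) : x + t *: v @[t --> (0 : R)^'+] --> x by [].
apply: cvg_at_right_filter.
rewrite -[X in _ --> X]addr0 -(scale0r v).
apply: cvgD; first exact: cvg_cst.
by apply: cvgZr_tmp; exact: cvg_id.
Qed.

End Near.

Section MeshGeometry.
Context {R : realType} {d : nat}.
Variable M : mesh R d.
Hypothesis d_gt0 : (0 < d)%N.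
Implicit Types (E T : {set vertex M}) (x : 'cV[R]_d).

Local Notation bar := (bary (pt M)).

Lemma cell_coord T : T \in cells M ->
  exists g k, is_barycentric (pt M) T g k.
Proof.
move=> TM; have iT := cell_independent TM.
by have [g [k gk]] := barycentric_coordinates iT (card_cell TM); exists g, k.
Qed.

Lemma cell_neq0 T : T \in cells M -> T != finset.set0.
Proof. by move=> TM; rewrite -card_gt0 card_cell. Qed.

Lemma card_face E : E \in faces M -> #|E| = d.
Proof. by rewrite inE => /andP[/eqP]. Qed.

Lemma face_neq0 E : E \in faces M -> E != finset.set0.
Proof. by move=> EM; rewrite -card_gt0 card_face. Qed.

Lemma face_cell E : E \in faces M -> exists2 T, T \in cells M & E \subset T.
Proof. by rewrite inE => /andP[_ /existsP[T /andP[]]]; exists T. Qed.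

Lemma faceD1 T a : T \in cells M -> a \in T -> T :\ a \in faces M.
Proof.
move=> TM aT; rewrite inE; apply/andP; split.
  by have := cardsD1 a T; rewrite aT card_cell // => -[/esym/eqP].
by apply/existsP; exists T; rewrite TM subD1set.
Qed.

Lemma face_opposite E T : E \in faces M -> T \in cells M -> E \subset T ->
  exists2 a, a \in T & E = T :\ a.
Proof.
move=> EM TM ET; have : #|T :\: E| = 1%N.
  by rewrite cardsD (finset.setIidPr ET) card_cell // card_face // subSnn.
move=> /eqP/cards1P[a aE].
have aT : a \in T :\: E by rewrite aE finset.set11.
exists a; first by move: aT; rewrite inE => /andP[].
by rewrite -aE finset.setDDr finset.setDv finset.set0U (finset.setIidPr ET).
Qed.

Lemma normal_dot E : E \in faces M -> dot (normal M E) (normal M E) = 1.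
Proof.
move=> EM; have := normal_unit EM; rewrite /enorm => /(congr1 (fun y => y ^+ 2)).
rewrite sqr_sqrtr ?expr1n // sumr_ge0 // => i _.
by rewrite -expr2 sqr_ge0.
Qed.

(** Signed distance from the barycenter of T to the hyperplane of E. Its sign tells on which side of
    E the cell lies. *)
Definition height E T : R := dot (normal M E) (bar T - bar E).

Lemma heightE T a : T \in cells M -> a \in T ->
  height (T :\ a) T = d.+1%:R^-1 * dot (normal M (T :\ a)) (pt M a - bar (T :\ a)).
Proof.
move=> TM aT; have [g [k gk]] := cell_coord TM.
have EM := faceD1 TM aT.
rewrite /height (normal_coord gk) ?face_neq0 //; last exact: normal_orthogonal.
rewrite (coord_bary (cell_independent TM) gk) ?cell_neq0 //.
by rewrite aT card_cell // mulrC.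
Qed.

(** The normal is a multiple of the gradient of the coordinate opposite to E; a zero height would
    make this unit vector vanish. *)
Lemma height_neq0 E T : E \in faces M -> T \in cells M -> E \subset T ->
  height E T != 0.
Proof.
move=> EM TM ET; have [a aT EE] := face_opposite EM TM ET; move: EM; rewrite EE => EM.
rewrite heightE // mulf_neq0 ?invr_eq0 ?pnatr_eq0 //.
have [g [k gk]] := cell_coord TM.
have nE := normal_grad gk aT (face_neq0 EM) (normal_orthogonal EM).
apply/eqP => h0; have := normal_dot EM.
by rewrite nE h0 scale0r dot0l => /eqP; rewrite eq_sym oner_eq0.
Qed.

(** The left-hand side does not depend on T, so this compares the coordinates of one point in two
    cells sharing E. *)
Lemma height_dot E T x : E \in faces M -> T \in cells M -> E \subset T ->
  forall g k, is_barycentric (pt M) T g k -> forall a, a \in T -> a \notin E ->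
  dot (normal M E) (x - bar E) = d.+1%:R * height E T * (dot (g a) x + k a).
Proof.
move=> EM TM ET g k gk a aT aE.
have EE : E = T :\ a.
  apply/eqP; rewrite eqEcard finset.subsetD1 ET aE /=.
  by rewrite (card_face (faceD1 TM aT)) card_face.
move: EM; rewrite EE => EM; rewrite heightE // mulrA divff ?pnatr_eq0 // mul1r.
by rewrite (normal_coord gk) ?face_neq0 //; exact: normal_orthogonal.
Qed.

(** The coordinate opposite to E vanishes on E and is nonnegative on T, so one interior point of T
    decides the sign. The vector m is general in order to cover both the normal and its opposite. *)
Lemma outward_height E T (m : 'cV[R]_d) : E \in faces M -> T \in cells M ->
  E \subset T -> {in E & , forall i j, dot m (pt M i - pt M j) = 0} ->
  outward (pt M) E m T <-> dot m (bar T - bar E) <= 0.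
Proof.
move=> EM TM ET; have [a aT EE] := face_opposite EM TM ET.
rewrite {E}EE in EM ET *; move=> mE.
have [g [k gk]] := cell_coord TM; have iT := cell_independent TM.
split=> [out|h0 x y xT yE].
  by apply: out; apply: open_simplexW; apply: open_simplex_bary;
    [exact: cell_neq0|exact: face_neq0].
have -> : x - y = (x - bar (T :\ a)) - (y - bar (T :\ a)).
  by rewrite opprB addrA subrK.
rewrite dotBr (normal_coord gk aT (face_neq0 EM) mE x).
rewrite (normal_coord gk aT (face_neq0 EM) mE y).
have [_ ->] := simplex_coord iT gk ET aT yE; last by rewrite !inE eqxx.
rewrite mulr0 subr0 mulr_le0_ge0 //; last first.
  by have [] := simplex_coord iT gk (subxx _) aT xT.
move: h0; rewrite (normal_coord gk aT (face_neq0 EM) mE).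
rewrite (coord_bary iT gk (subxx _) (cell_neq0 TM) aT) aT.
by rewrite pmulr_lle0 // invr_gt0 ltr0n card_cell.
Qed.

Lemma outward_normal E T : E \in faces M -> T \in cells M -> E \subset T ->
  outward (pt M) E (normal M E) T <-> height E T < 0.
Proof.
move=> EM TM ET; rewrite outward_height //; last exact: normal_orthogonal.
by rewrite [_ < 0]lt_neqAle height_neq0.
Qed.

Lemma inward_normal E T : E \in faces M -> T \in cells M -> E \subset T ->
  outward (pt M) E (- normal M E) T <-> 0 < height E T.
Proof.
move=> EM TM ET; rewrite outward_height //; last first.
  by move=> i j iE jE; rewrite dotNl (normal_orthogonal EM) ?oppr0.
by rewrite dotNl oppr_le0 lt_neqAle eq_sym height_neq0.
Qed.

(* Points of T close to the barycenter of E also lie in T'. *)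
Lemma same_side E T T' : E \in faces M -> T \in cells M -> T' \in cells M ->
  E \subset T -> E \subset T' -> 0 < height E T * height E T' -> T = T'.
Proof.
move=> EM TM TM' ET ET' hh.
have [a aT EE] := face_opposite EM TM ET.
have [b bT' EE'] := face_opposite EM TM' ET'.
have aE : a \notin E by rewrite EE !inE eqxx.
have bE : b \notin E by rewrite EE' !inE eqxx.
have [g [k gk]] := cell_coord TM; have iT := cell_independent TM.
have [g' [k' gk']] := cell_coord TM'; have iT' := cell_independent TM'.
case: (boolP (a \in T')) => [aT'|aT'].
  apply/eqP; rewrite eqEcard (card_cell TM) (card_cell TM') leqnn andbT.
  rewrite -(finset.setD1K aT) -EE; apply/fintype.subsetP => i.
  by rewrite finset.in_setU1 => /predU1P[->//|]; exact: (fintype.subsetP ET').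
exfalso; have E0 := face_neq0 EM.
(* T and T' being on the same side of E, the vertex a lies on the side of E where the coordinate of
   b is positive. *)
have bpos : 0 < dot (g' b) (pt M a) + k' b.
  have := height_dot (pt M a) EM TM ET gk aT aE.
  rewrite (height_dot _ EM TM' ET' gk' bT' bE) (coord_vertex iT gk) // eqxx mulr1.
  rewrite -mulrA => /(mulfI _) e; rewrite -(pmulr_rgt0 _ hh).
  rewrite -mulrA e ?pnatr_eq0 // -expr2 exprn_even_gt0 //=.
  exact: height_neq0.
near (0 : R)^'+ => t.
have t0 : 0 < t by near: t; exact: nbhs_right_gt.
have t1 : t < 1 by near: t; apply: nbhs_right_lt; exact: ltr01.
pose x := bar E + t *: (pt M a - bar E).
have xa : dot (g a) x + k a = t.
  rewrite coord_line (coord_bary iT gk) // (negPf aE).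
  by rewrite (coord_vertex iT gk) // eqxx mulr0 add0r mulr1.
have xT : simplex (pt M) T x.
  apply: (coord_simplex gk) => i iT0; rewrite coord_line.
  rewrite (coord_bary iT gk) // (coord_vertex iT gk) //.
  apply: addr_ge0; apply: mulr_ge0; rewrite ?ler0n ?subr_ge0 //; try exact: ltW.
  by case: ifP => // _; rewrite invr_ge0 ler0n.
have xE : forall i, i \in E -> 0 < dot (g' i) x + k' i.
  rewrite /x; near: t; apply: filter_forall => i.
  have [iE|_] := boolP (i \in E); last by apply: nearW.
  have bi : 0 < dot (g' i) (bar E) + k' i.
    rewrite (coord_bary iT' gk') // ?iE ?invr_gt0 ?ltr0n ?card_gt0 //.
    exact: (fintype.subsetP ET').
  near=> s => _; rewrite dotDr (dotZr _ s) addrAC.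
  near: s; exact: near_affine_gt0.
have xT' : simplex (pt M) T' x.
  apply: (coord_simplex gk') => j jT'; apply: ltW.
  have [->|jb] := eqVneq j b; last by apply: xE; rewrite EE' !inE jb.
  rewrite coord_line (coord_bary iT' gk') // (negPf bE) mulr0 add0r.
  by rewrite mulr_gt0.
(* By conformity x lies in the common face, which lacks a; yet its coordinate at a is t > 0. *)
have : simplex (pt M) (T :&: T')%SET x.
  by rewrite -cells_conforming //; split.
move=> /(simplex_coord iT gk (finset.subsetIl _ _) aT)[_].
by rewrite !inE negb_and aT' orbT xa => /(_ isT)/eqP; rewrite gt_eqF.
Unshelve. all: by end_near.
Qed.

Lemma cell_closure T : T \in cells M -> simplex (pt M) T `<=` closure (Omega M).
Proof. by move=> TM x xT; rewrite cells_cover; exists T. Qed.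

(** Not being a boundary face only yields a point of the closed simplex E off the boundary of the
    domain. A small move towards the barycenter of E brings it into the relative interior without
    leaving the open domain. *)
Lemma interior_face_point E : interior_face E ->
  exists2 x, open_simplex (pt M) E x & nbhs x (Omega M).
Proof.
move=> /andP[EM]; rewrite /boundary_face EM /= => /asboolPn nE.
have [T TM ET] := face_cell EM.
have [g [k gk]] := cell_coord TM; have iT := cell_independent TM.
have [x [xE xO]] : exists x, simplex (pt M) E x /\ ~ boundary (Omega M) x.
  by apply: contra_notP nE => H x xE; apply: contrapT => xO; apply: H; exists x.
have {}xO : (Omega M)° x.
  apply: contrapT => nx; apply: xO; split=> //.
  by apply: (cell_closure TM); apply: simplex_sub xE.
near (0 : R)^'+ => t.
exists (x + t *: (bar E - x)).
  have t0 : 0 < t by near: t; exact: nbhs_right_gt.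
  have t1 : t < 1 by near: t; apply: nbhs_right_lt; exact: ltr01.
  have [c [c0 c1 xE']] := xE.
  exists (fun i => (1 - t) * c i + t * #|E|%:R^-1); split.
  - move=> i iE; rewrite ltr_wpDl ?mulr_ge0 ?c0 ?subr_ge0 ?ltW //.
    by rewrite mulr_gt0 // invr_gt0 ltr0n card_gt0 face_neq0.
  - rewrite big_split /= -!mulr_sumr c1 sum_bary_weights ?face_neq0 //.
    by rewrite !mulr1 subrK.
  - under eq_bigr do rewrite scalerDl -!scalerA.
    rewrite big_split /= -!scaler_sumr -xE' -/(bary (pt M) E).
    by rewrite scalerBr scalerBl scale1r addrAC addrA.
near: t; apply: (near_line (A := (Omega M)°)).
exact: nbhs_interior.
Unshelve. all: by end_near.
Qed.

(* A cell containing points arbitrarily close to an interior point of E, on the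
   side of E opposite to T, also contains this point by finiteness of the mesh,
   hence has E as a face by conformity. *)
Lemma opposite_cell E T : interior_face E -> T \in cells M -> E \subset T ->
  exists T', [/\ T' \in cells M, E \subset T' & height E T * height E T' < 0].
Proof.
move=> EI TM ET; have EM : E \in faces M by case/andP: EI.
have [a aT EE] := face_opposite EM TM ET.
have aE : a \notin E by rewrite EE !inE eqxx.
have [g [k gk]] := cell_coord TM; have iT := cell_independent TM.
have [y yE yO] := interior_face_point EI.
have yT : simplex (pt M) T y by apply: simplex_sub ET _ (open_simplexW yE).
have ya : dot (g a) y + k a = 0.
  by have [_ ->] := simplex_coord iT gk ET aT (open_simplexW yE).
near (0 : R)^'+ => t.
have t0 : 0 < t by near: t; exact: nbhs_right_gt.
(* z lies just beyond y on the ray from a, hence on the other side of E. *)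
pose z := y + t *: (y - pt M a).
have za : dot (g a) z + k a = - t.
  rewrite /z dotDr dotZr dotBr; have := coord_vertex iT gk aT aT.
  rewrite eqxx /= => e1.
  have -> : dot (g a) y - dot (g a) (pt M a) = -1 by lra.
  lra.
(* A cell missing y has a negative coordinate at y, which stays negative at z for small t; there are
   finitely many cells. *)
have zy : forall T', T' \in cells M -> simplex (pt M) T' z -> simplex (pt M) T' y.
  rewrite /z; near: t; apply: filter_forall => T'.
  have [TM'|_] := boolP (T' \in cells M); last by apply: nearW.
  have [g' [k' gk']] := cell_coord TM'; have iT' := cell_independent TM'.
  have [yT'|yT'] := pselect (simplex (pt M) T' y); first by apply: nearW.
  have [i iT0 yi] : exists2 i, i \in T' & dot (g' i) y + k' i < 0.
    apply: contra_notP yT' => H; apply: (coord_simplex gk') => i iT0.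
    by rewrite leNgt; apply/negP => yi; apply: H; exists i.
  near=> s => _ /(simplex_coord iT' gk' (subxx _) iT0)[+ _].
  rewrite dotDr (dotZr _ s) addrAC leNgt => /negP[].
  rewrite -oppr_gt0 opprD -mulrN.
  by near: s; apply: near_affine_gt0; rewrite oppr_gt0.
have : closure (Omega M) z.
  apply: subset_closure; rewrite /z; near: t; exact: near_line.
rewrite cells_cover => -[T' /= TM' zT'].
have yT' := zy T' TM' zT'.
(* All the coordinates of y on E are positive, so every vertex of E belongs to the common face of T
   and T'. *)
have ET' : E \subset T'.
  have : simplex (pt M) (T :&: T')%SET y by rewrite -cells_conforming //; split.
  move=> yTT'; apply/fintype.subsetP => i iE.
  have iT0 : i \in T := fintype.subsetP ET i iE.
  have [_ H] := simplex_coord iT gk (finset.subsetIl T T') iT0 yTT'.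
  have := open_simplex_coord iT gk ET iE yE.
  apply: contraTT => iT'; rewrite H ?ltxx //.
  by rewrite inE negb_and iT' orbT.
exists T'; split=> //.
have [b bT' EE'] := face_opposite EM TM' ET'.
have bE : b \notin E by rewrite EE' !inE eqxx.
have [g' [k' gk']] := cell_coord TM'; have iT' := cell_independent TM'.
(* The normal component of z, computed in both cells, equates - t times the height of T with a
   nonnegative multiple of the height of T'. *)
have := height_dot z EM TM ET gk aT aE.
rewrite (height_dot z EM TM' ET' gk' bT' bE) za -!mulrA => /(mulfI _) e.
have [zb _] := simplex_coord iT' gk' (subxx _) bT' zT'.
rewrite ltNge; apply/negP => hh.
have : 0 <= height E T * height E T' * (dot (g' b) z + k' b) by rewrite mulr_ge0.
rewrite -mulrA e ?pnatr_eq0 // mulrA mulrN oppr_ge0 pmulr_lle0 //.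
by rewrite -expr2 leNgt exprn_even_gt0 //= height_neq0.
Unshelve. all: by end_near.
Qed.

End MeshGeometry.

(** * The cells on either side of a face *)

Section CellsOfFaces.
Context {R : realType} {d : nat}.
Variable M : mesh R d.
Hypothesis d_gt0 : (0 < d)%N.
Implicit Types (E T : {set vertex M}).

(** A cell of negative height ensures that [pick] does not fall back on the empty set. *)
Lemma cell_plusP E : E \in faces M ->
  (exists T, [/\ T \in cells M, E \subset T & height E T < 0]) ->
  [/\ cell_plus E \in cells M, E \subset cell_plus E & height E (cell_plus E) < 0].
Proof.
move=> EM [T [TM ET hT]]; rewrite /cell_plus; case: pickP => [T'|/(_ T)] /=.
  by move=> /and3P[TM' ET' /asboolP]; rewrite outward_normal.
rewrite TM ET /= => /asboolP[]; exact/(outward_normal d_gt0 EM TM ET).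
Qed.

Lemma cell_minusP E : E \in faces M ->
  (exists T, [/\ T \in cells M, E \subset T & 0 < height E T]) ->
  [/\ cell_minus E \in cells M, E \subset cell_minus E & 0 < height E (cell_minus E)].
Proof.
move=> EM [T [TM ET hT]]; rewrite /cell_minus; case: pickP => [T'|/(_ T)] /=.
  by move=> /and3P[TM' ET' /asboolP]; rewrite inward_normal.
rewrite TM ET /= => /asboolP[]; exact/(inward_normal d_gt0 EM TM ET).
Qed.

(** One cell containing E and the one across it have heights of opposite signs, and the signs decide
    which is which. *)
Lemma interior_cells E : interior_face E ->
  [/\ cell_plus E \in cells M, E \subset cell_plus E & height E (cell_plus E) < 0] /\
  [/\ cell_minus E \in cells M, E \subset cell_minus E & 0 < height E (cell_minus E)].
Proof.
move=> EI; have EM : E \in faces M by case/andP: EI.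
have [T TM ET] := face_cell EM; have [T' [TM' ET' hh]] := opposite_cell d_gt0 EI TM ET.
have h0 := height_neq0 d_gt0 EM TM ET.
case: (ltrgt0P (height E T)) hh h0 => // hT.
  by rewrite pmulr_rlt0 // => hT' _; split;
    [apply: cell_plusP => //; exists T'|apply: cell_minusP => //; exists T].
by rewrite nmulr_rlt0 // => hT' _; split;
  [apply: cell_plusP => //; exists T|apply: cell_minusP => //; exists T'].
Qed.

Lemma boundary_height E T : boundary_face E -> T \in cells M -> E \subset T ->
  height E T < 0.
Proof.
move=> /andP[EM /asboolP Eb] TM ET.
by apply/(outward_normal d_gt0 EM TM ET); apply: normal_outward.
Qed.

Lemma boundary_cell E : boundary_face E ->
  cell_plus E \in cells M /\ E \subset cell_plus E.
Proof.
move=> Eb; have EM : E \in faces M by case/andP: Eb.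
have [T TM ET] := face_cell EM.
have [] // := cell_plusP EM _; exists T; split=> //; exact: boundary_height.
Qed.

Lemma interior_cell_cases E T : interior_face E -> T \in cells M -> E \subset T ->
  T = cell_plus E \/ T = cell_minus E.
Proof.
move=> EI TM ET; have EM : E \in faces M by case/andP: EI.
have [[pM Ep hp] [mM Em hm]] := interior_cells EI.
have h0 := height_neq0 d_gt0 EM TM ET.
case: (ltrgt0P (height E T)) h0 => // hT _; [right|left].
  by apply: (same_side d_gt0 EM) => //; rewrite mulr_gt0.
by apply: (same_side d_gt0 EM) => //; rewrite nmulr_rgt0.
Qed.

Lemma boundary_cell_eq E T : boundary_face E -> T \in cells M -> E \subset T ->
  T = cell_plus E.
Proof.
move=> Eb TM ET; have EM : E \in faces M by case/andP: Eb.
have [pM Ep] := boundary_cell Eb.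
apply: (same_side d_gt0 EM) => //.
by rewrite nmulr_rgt0 boundary_height.
Qed.

Lemma sum_cells_interior (F : {set vertex M} -> R) E : interior_face E ->
  \sum_(T in cells M | E \subset T) F T = F (cell_plus E) + F (cell_minus E).
Proof.
move=> EI; have [[pM Ep hp] [mM Em hm]] := interior_cells EI.
rewrite (bigD1 (cell_plus E)) ?pM //= (bigD1 (cell_minus E)) /=; last first.
  rewrite mM Em /=; apply: contraTneq hm => ->.
  by rewrite -leNgt ltW.
rewrite big1 ?addr0 // => T /andP[/andP[/andP[TM ET]]].
by have [->|->] := interior_cell_cases EI TM ET; rewrite eqxx.
Qed.

Lemma sum_cells_boundary (F : {set vertex M} -> R) E : boundary_face E ->
  \sum_(T in cells M | E \subset T) F T = F (cell_plus E).
Proof.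
move=> Eb; have [pM Ep] := boundary_cell Eb.
rewrite (bigD1 (cell_plus E)) ?pM //= big1 ?addr0 // => T /andP[/andP[TM ET]].
by rewrite -(boundary_cell_eq Eb TM ET) eqxx.
Qed.

Lemma face_cases E : E \in faces M -> interior_face E \/ boundary_face E.
Proof.
by move=> EM; rewrite /interior_face EM; case: (boundary_face E); [right|left].
Qed.

Lemma interiorF_boundary E : boundary_face E -> interior_face E = false.
Proof. by rewrite /interior_face => ->; rewrite andbF. Qed.

Lemma dirichlet_neumann E : boundary_face E ->
  dirichlet_face E = ~~ neumann_face E.
Proof.
move=> Eb; have /andP[EM /asboolP Eb'] := Eb.
rewrite /dirichlet_face /neumann_face Eb /= -asbool_neg; apply: asbool_equiv_eq.
have [[D|N] DN] := boundary_faces_split EM Eb'; split=> // H.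
- by move=> N; apply: DN.
- by move=> _; apply: DN.
Qed.

End CellsOfFaces.

(** * Affine fields on the mesh *)

Section Affine.
Context {R : realType} {d : nat}.
Implicit Types (q : 'cV[R]_d -> 'cV[R]_d) (f : 'cV[R]_d -> R).

Lemma P1D q q' : P1 q -> P1 q' -> P1 (fun x => q x + q' x).
Proof.
move=> [A [b qE]] [A' [b' qE']]; exists (A + A'), (b + b') => x.
by rewrite qE qE' mulmxDl addrACA.
Qed.

Lemma P1Z a q : P1 q -> P1 (fun x => a *: q x).
Proof.
move=> [A [b qE]]; exists (a *: A), (a *: b) => x.
by rewrite qE scalerDr scalemxAl.
Qed.

Lemma P1B q q' : P1 q -> P1 q' -> P1 (fun x => q x - q' x).
Proof.
move=> Pq Pq'; have := P1D Pq (P1Z (-1) Pq').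
by congr P1; apply/funext => x; rewrite scaleN1r.
Qed.

Lemma P1_sum (I : Type) (r : seq I) (P : pred I) (q : I -> 'cV[R]_d -> 'cV[R]_d) :
  (forall i, P1 (q i)) -> P1 (fun x => \sum_(i <- r | P i) q i x).
Proof.
move=> Pq; elim: r => [|i r IH].
  by exists 0, 0 => x; rewrite big_nil mul0mx addr0.
case Pi : (P i).
  have := P1D (Pq i) IH; congr P1; apply/funext => x.
  by rewrite big_cons Pi.
by move: IH; congr P1; apply/funext => x; rewrite big_cons Pi.
Qed.

Lemma P1_rank1 (g w : 'cV[R]_d) (k : R) : P1 (fun x => (dot g x + k) *: w).
Proof.
exists (w *m g^T), (k *: w) => x; rewrite scalerDl -mulmxA; congr (_ + _).
apply/colP => i; rewrite !mxE big_ord1 mulrC !mxE; congr (_ * _).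
by apply: eq_bigr => j _; rewrite mxE.
Qed.

Lemma P1_combination q (I : Type) (r : seq I) (P : pred I) (c : I -> R)
    (p : I -> 'cV[R]_d) : P1 q -> \sum_(i <- r | P i) c i = 1 ->
  q (\sum_(i <- r | P i) c i *: p i) = \sum_(i <- r | P i) c i *: q (p i).
Proof.
move=> [A [b qE]] c1; under [RHS]eq_bigr do rewrite qE scalerDr.
rewrite qE mulmx_sumr big_split /= -scaler_suml c1 scale1r; congr (_ + _).
by apply: eq_bigr => i _; rewrite scalemxAr.
Qed.

Lemma P1_line q x y (t : R) : P1 q ->
  q (x + t *: (y - x)) = (1 - t) *: q x + t *: q y.
Proof.
move=> [A [b qE]]; rewrite !qE mulmxDr -scalemxAr mulmxBr.
by rewrite !scalerBl !scalerDr scale1r !scalerN; apply/colP => i; rewrite !mxE; ring.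
Qed.

Definition affine_fun f := exists l c, forall x, f x = dot l x + c.

Lemma affine_cst c : affine_fun (fun=> c).
Proof. by exists 0, c => x; rewrite dot0l add0r. Qed.

Lemma affineD f f' : affine_fun f -> affine_fun f' ->
  affine_fun (fun x => f x + f' x).
Proof.
move=> [l [c fE]] [l' [c' fE']]; exists (l + l'), (c + c') => x.
by rewrite fE fE' dotDl addrACA.
Qed.

Lemma dot_mulmx (u x : 'cV[R]_d) (A : 'M[R]_d) : dot u (A *m x) = dot (A^T *m u) x.
Proof.
rewrite /dot; under eq_bigr do rewrite mxE mulr_sumr.
rewrite exchange_big /=; apply: eq_bigr => j _; rewrite mxE mulr_suml.
by apply: eq_bigr => i _; rewrite mxE mulrCA mulrA mulrAC -mulrA mulrC.
Qed.

Lemma affine_dot q u : P1 q -> affine_fun (fun x => dot u (q x)).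
Proof.
move=> [A [b qE]]; exists (A^T *m u), (dot u b) => x.
by rewrite qE dotDr dot_mulmx.
Qed.

Lemma affine_coord q i : P1 q -> affine_fun (fun x => q x i 0).
Proof.
move=> Pq; have [l [c H]] := affine_dot (delta_mx i 0) Pq.
by exists l, c => x; rewrite -H dotC dot_delta.
Qed.

Lemma integral_affine (V : finType) (pt : V -> 'cV[R]_d) (S : {set V}) f :
  S != finset.set0 -> affine_fun f ->
  integral_simplex pt S f = area pt S * f (bary pt S).
Proof.
move=> S0 [l [c fE]]; have -> : f = fun x => dot l x + c by apply/funext.
exact: integral_simplex_affine.
Qed.

End Affine.

(** * Interpolation at face barycenters and the direct sum *)

Section CellAffine.
Context {R : realType} {d : nat}.
Variable M : mesh R d.
Hypothesis d_gt0 : (0 < d)%N.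
Implicit Types (E T : {set vertex M}) (q u v z : 'cV[R]_d -> 'cV[R]_d).
Local Notation bar := (bary (pt M)).

Lemma P1_bary T q : T \in cells M -> P1 q -> forall a, a \in T ->
  d%:R *: q (bar (T :\ a)) = \sum_(i in T) q (pt M i) - q (pt M a).
Proof.
move=> TM Pq a aT; have EM := faceD1 TM aT.
rewrite bary_sum P1_combination ?sum_bary_weights ?face_neq0 //.
rewrite card_face // -scaler_sumr scalerA divff ?scale1r ?pnatr_eq0 -?lt0n //.
rewrite [in RHS](bigD1 a) //= [RHS]addrAC subrr add0r; apply: eq_bigl => i.
by rewrite !inE andbC.
Qed.

Lemma P1_vertices T q : T \in cells M -> P1 q ->
  (forall i, i \in T -> q (pt M i) = 0) -> forall x, q x = 0.
Proof.
move=> TM Pq q0 x; have [g [k gk]] := cell_coord TM; have [e1 e2] := gk x.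
by rewrite -e2 P1_combination // big1 // => i iT; rewrite q0 ?scaler0.
Qed.

(** By [P1_bary] every vertex value equals the sum Q of all d + 1 of them, so Q = (d + 1) Q and Q =
    0. *)
Lemma P1_face_values T q : T \in cells M -> P1 q ->
  (forall a, a \in T -> q (bar (T :\ a)) = 0) -> forall x, q x = 0.
Proof.
move=> TM Pq q0; apply: (P1_vertices TM Pq) => a aT.
set Q := \sum_(i in T) q (pt M i).
have qE i : i \in T -> q (pt M i) = Q.
  move=> iT; have := P1_bary TM Pq iT; rewrite q0 // scaler0 => /esym/eqP.
  by rewrite subr_eq0 => /eqP.
rewrite qE //; have : Q = d.+1%:R *: Q.
  rewrite {1}/Q; under eq_bigr => i iT do rewrite qE //.
  by rewrite sumr_const card_cell // scaler_nat.
rewrite -natr1 scalerDl scale1r -[X in X = _]add0r => /addIr/esym/eqP.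
by rewrite scaler_eq0 pnatr_eq0 eqn0Ngt d_gt0 => /eqP.
Qed.

(** Summing [P1_bary] over the faces shows that the vertex values must have the sum W of the
    prescribed face values. Hence the value at vertex i is W - d w_i. *)
Lemma P1_interpolation T (w : vertex M -> 'cV[R]_d) : T \in cells M ->
  exists2 q, P1 q & forall a, a \in T -> q (bar (T :\ a)) = w a.
Proof.
move=> TM; have [g [k gk]] := cell_coord TM; have iT := cell_independent TM.
set W := \sum_(i in T) w i.
exists (fun x => \sum_(i in T) (dot (g i) x + k i) *: (W - d%:R *: w i)).
  by apply: P1_sum => i; exact: P1_rank1.
move=> a aT; have EM := faceD1 TM aT.
have dn0 : d%:R != 0 :> R by rewrite pnatr_eq0 -lt0n.
rewrite (bigD1 a) //= (coord_bary iT gk) ?face_neq0 ?subD1set // !inE eqxx /=.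
rewrite scale0r add0r.
transitivity (\sum_(i in T | i != a) (d%:R^-1 *: W - w i)).
  apply: eq_bigr => i /andP[iT0 ia].
  rewrite (coord_bary iT gk) ?face_neq0 ?subD1set // !inE ia iT0 /= card_face //.
  by rewrite scalerBr scalerA mulVf // scale1r.
rewrite sumrB.
have -> : \sum_(i in T | i != a) w i = W - w a.
  by rewrite /W [in RHS](bigD1 a) //= [RHS]addrAC subrr add0r.
have -> : \sum_(i in T | i != a) d%:R^-1 *: W = W.
  rewrite sumr_const.
  have -> : #|[pred i in T | i != a]| = d.
    apply: etrans (card_face EM); apply: eq_card => i; rewrite !inE; exact: andbC.
  by rewrite -scaler_nat scalerA divff // scale1r.
by rewrite opprB addrCA subrr addr0.
Qed.

(** The difference vanishes at the barycenter and at its midpoint with each vertex, both in the open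
    simplex, hence at the vertices. *)
Lemma P1_open_simplex_eq T q q' : T \in cells M -> P1 q -> P1 q' ->
  (forall x, open_simplex (pt M) T x -> q x = q' x) -> q = q'.
Proof.
move=> TM Pq Pq' qq'; have [g [k gk]] := cell_coord TM.
have iT := cell_independent TM; have T0 := cell_neq0 TM.
apply/funext => x; apply/eqP; rewrite -subr_eq0; apply/eqP.
have Pr := P1B Pq Pq'; apply: (P1_vertices TM Pr) => i iT0.
have := P1_line (bar T) (pt M i) 2^-1 Pr.
have ob := open_simplex_bary (pt M) T0.
rewrite (qq' (bar T)) // subrr scaler0 add0r qq'; last first.
  apply: (coord_open_simplex gk) => j jT; rewrite coord_line.
  rewrite (coord_bary iT gk) // jT (coord_vertex iT gk) //; apply: ltr_wpDr.
    by rewrite mulr_ge0 ?invr_ge0 ?ler0n.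
  by rewrite mulr_gt0 ?invr_gt0 ?ltr0n ?card_gt0 // subr_gt0 invf_lt1 // ltr1n.
by rewrite subrr => /esym/eqP; rewrite scaler_eq0 invr_eq0 pnatr_eq0 /= => /eqP.
Qed.

Lemma restrP u T : VDG M u -> T \in cells M ->
  P1 (restr u T) /\ forall x, open_simplex (pt M) T x -> u x = restr u T x.
Proof.
move=> uV TM; have [q Pq uq] := uV T TM; rewrite /restr.
exact: (@xgetI _ (fun=> 0) [set q : 'cV[R]_d -> 'cV[R]_d | P1 q /\
  forall x, open_simplex (pt M) T x -> u x = q x] q (conj Pq uq)).
Qed.

Lemma restr_eq u T q : T \in cells M -> P1 q ->
  (forall x, open_simplex (pt M) T x -> u x = q x) -> restr u T = q.
Proof.
move=> TM Pq uq; rewrite /restr.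
have [Pr ur] := @xgetI _ (fun=> 0) [set q : 'cV[R]_d -> 'cV[R]_d | P1 q /\
    forall x, open_simplex (pt M) T x -> u x = q x] q (conj Pq uq).
by apply: (P1_open_simplex_eq TM) => // x xT; rewrite -ur // uq.
Qed.

(** All the coordinates of x in T are positive, and by conformity x lies in the common face, which
    must then contain every vertex of T. *)
Lemma open_simplex_cell_inj T T' x : T \in cells M -> T' \in cells M ->
  open_simplex (pt M) T x -> open_simplex (pt M) T' x -> T = T'.
Proof.
move=> TM TM' xT xT'; have [g [k gk]] := cell_coord TM.
have iT := cell_independent TM.
apply/eqP; rewrite eqEcard (card_cell TM) (card_cell TM') leqnn andbT.
have xTT' : simplex (pt M) (T :&: T')%SET x.
  by rewrite -cells_conforming //; split; exact: open_simplexW.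
apply/fintype.subsetP => i iT0.
have := open_simplex_coord iT gk (subxx _) iT0 xT; apply: contraTT => iT'.
have [_ ->] := simplex_coord iT gk (finset.subsetIl T T') iT0 xTT'.
  by rewrite ltxx.
by rewrite inE negb_and iT' orbT.
Qed.

Lemma glue (Q : {set vertex M} -> 'cV[R]_d -> 'cV[R]_d) :
  exists u, forall T, T \in cells M ->
    forall x, open_simplex (pt M) T x -> u x = Q T x.
Proof.
exists (fun x => if [pick T in cells M | `[< open_simplex (pt M) T x >]] is Some T
                 then Q T x else 0) => T TM x xT.
case: pickP => [T' /andP[TM' /asboolP xT']|/(_ T)].
  by rewrite (open_simplex_cell_inj TM TM' xT xT').
by rewrite TM /= => /asboolP.
Qed.

Lemma face_area_gt0 E : E \in faces M -> 0 < area (pt M) E.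
Proof.
move=> EM; have [T TM ET] := face_cell EM; have [a aT EE] := face_opposite EM TM ET.
have nn := normal_dot EM; have nE := normal_orthogonal EM.
rewrite {1}EE; rewrite EE in nn nE.
by have [] := area_face d_gt0 (cell_independent TM) (card_cell TM) aT nn nE.
Qed.

Lemma P0_affine E q : E \in faces M -> P1 q -> P0 E q = q (bar E).
Proof.
move=> EM Pq; rewrite /P0 /mean; apply/colP => i; rewrite !mxE.
rewrite (integral_affine _ (face_neq0 d_gt0 EM) (affine_coord i Pq)).
by rewrite -/(area _ _) mulKf // gt_eqF // face_area_gt0.
Qed.

Lemma P1_jump E u : VDG M u -> E \in faces M -> P1 (jump E (restr u)).
Proof.
move=> uV EM; have [EI|Eb] := face_cases EM; rewrite /jump.
  rewrite EI; have [[pM _ _] [mM _ _]] := interior_cells d_gt0 EI.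
  by apply: P1B; apply: (proj1 (restrP uV _)).
rewrite interiorF_boundary //; have [pM _] := boundary_cell d_gt0 Eb.
exact: (proj1 (restrP uV pM)).
Qed.

Lemma P1_average E u : VDG M u -> E \in faces M -> P1 (average E (restr u)).
Proof.
move=> uV EM; have [EI|Eb] := face_cases EM; rewrite /average.
  rewrite EI; have [[pM _ _] [mM _ _]] := interior_cells d_gt0 EI.
  by apply: P1Z; apply: P1D; apply: (proj1 (restrP uV _)).
rewrite interiorF_boundary //; have [pM _] := boundary_cell d_gt0 Eb.
exact: (proj1 (restrP uV pM)).
Qed.

Lemma VCR_jump v E : VCR M v -> interior_face E || dirichlet_face E ->
  jump E (restr v) (bar E) = 0.
Proof.
move=> [vV v0] EID; have EM : E \in faces M.
  by case/orP: EID => [/andP[]//|/andP[/andP[]]].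
by rewrite -P0_affine ?v0 //; exact: P1_jump.
Qed.

Lemma VZ_average z E : VZ M z -> interior_face E || neumann_face E ->
  average E (restr z) (bar E) = 0.
Proof.
move=> [zV z0] EIN; have EM : E \in faces M.
  by case/orP: EIN => [/andP[]//|/andP[/andP[]]].
by rewrite -P0_affine ?z0 //; exact: P1_average.
Qed.

(** On an interior face, zero jump and zero average annihilate both traces; on a boundary face
    exactly one of the two conditions applies, and it is about the single trace. *)
Lemma VCR_VZ_eq0 u : VCR M u -> VZ M u -> dg_eq M u (fun=> 0).
Proof.
move=> uC uZ T TM x xT; have uV : VDG M u by case: uC.
have [Pq uq] := restrP uV TM; rewrite uq //; apply: (P1_face_values TM Pq) => a aT.
have EM := faceD1 TM aT; have ET : T :\ a \subset T by rewrite subD1set.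
move: (T :\ a) EM ET => E EM ET.
have [EI|Eb] := face_cases EM.
  have := VCR_jump uC (E := E); have := VZ_average uZ (E := E).
  rewrite /average /jump EI => /(_ isT)/eqP + /(_ isT)/eqP.
  rewrite scaler_eq0 invr_eq0 pnatr_eq0 /= subr_eq0 => + /eqP pm.
  rewrite pm -mulr2n -scaler_nat scaler_eq0 pnatr_eq0 /= => /eqP m0.
  by have [->|->] := interior_cell_cases d_gt0 EI TM ET; rewrite ?pm m0.
rewrite (boundary_cell_eq d_gt0 Eb TM ET).
have := VCR_jump uC (E := E); have := VZ_average uZ (E := E).
rewrite /average /jump interiorF_boundary // dirichlet_neumann //=.
by case: (neumann_face E) => [/(_ isT)|_ /(_ isT)].
Qed.

Lemma VDG_decomposition u : VDG M u ->
  exists v z, [/\ VCR M v, VZ M z & dg_eq M u (fun x => v x + z x)].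
Proof.
move=> uV; set U := restr (M := M) u.
(* Values of v at the face barycenters. On interior faces they do not depend on T, so v has no mean
   jump; z takes what remains of u. *)
pose val E T := if interior_face E then average E U (bar E)
  else if dirichlet_face E then 0 else U T (bar E).
have /choice[Q QP] : forall T, exists q, T \in cells M -> P1 q /\
    forall a, a \in T -> q (bar (T :\ a)) = val (T :\ a) T.
  move=> T; have [TM|_] := boolP (T \in cells M); last by exists 0.
  by have [q] := P1_interpolation (fun a => val (T :\ a) T) TM; exists q.
have QE E T : E \in faces M -> T \in cells M -> E \subset T ->
    Q T (bar E) = val E T.
  move=> EM TM ET; have [a aT ->] := face_opposite EM TM ET.
  by have [_ ->] := QP T TM.
have [v vQ] := glue Q.
have vV : VDG M v by move=> T TM; exists (Q T); [case: (QP T TM)|exact: vQ].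
have rv T : T \in cells M -> restr v T = Q T.
  by move=> TM; apply: restr_eq => //; [case: (QP T TM)|exact: vQ].
pose z x := u x - v x.
have zU T : T \in cells M -> forall x, open_simplex (pt M) T x ->
    z x = U T x - Q T x.
  move=> TM x xT; rewrite /z (vQ T) //; congr (_ - _).
  by have [_ ->] := restrP uV TM.
have PUQ T : T \in cells M -> P1 (fun x => U T x - Q T x).
  by move=> TM; apply: P1B; [case: (restrP uV TM)|case: (QP T TM)].
have zV : VDG M z by move=> T TM; exists (fun x => U T x - Q T x); auto.
have rz T : T \in cells M -> restr z T = fun x => U T x - Q T x.
  by move=> TM; apply: restr_eq; auto.
exists v, z; split; last by move=> T TM x _; rewrite /z addrCA subrr addr0.
- split=> // E /orP[EI|ED].
    have EM : E \in faces M by case/andP: EI.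
    rewrite P0_affine //; last exact: P1_jump.
    have [[pM Ep _] [mM Em _]] := interior_cells d_gt0 EI.
    by rewrite /jump EI !rv // !QE // /val EI subrr.
  have Eb : boundary_face E by case/andP: ED.
  have EM : E \in faces M by case/andP: Eb.
  rewrite P0_affine //; last exact: P1_jump.
  have [pM Ep] := boundary_cell d_gt0 Eb.
  by rewrite /jump interiorF_boundary // rv // QE // /val interiorF_boundary // ED.
- split=> // E /orP[EI|EN].
    have EM : E \in faces M by case/andP: EI.
    rewrite P0_affine //; last exact: P1_average.
    have [[pM Ep _] [mM Em _]] := interior_cells d_gt0 EI.
    rewrite /average EI !rz // !QE // /val EI /average EI.
    move: (U _ _) (U _ _) => a b; apply/colP => i; rewrite !mxE; lra.
  have Eb : boundary_face E by case/andP: EN.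
  have EM : E \in faces M by case/andP: Eb.
  rewrite P0_affine //; last exact: P1_average.
  have [pM Ep] := boundary_cell d_gt0 Eb.
  rewrite /average interiorF_boundary // rz // QE // /val interiorF_boundary //.
  by rewrite dirichlet_neumann // EN subrr.
Qed.

End CellAffine.

(** * Integration by parts and orthogonality *)

Section Elasticity.
Context {R : realType} {d : nat}.
Implicit Types (A B : 'M[R]_d) (q : 'cV[R]_d -> 'cV[R]_d).

Lemma grad_affine q A b x : (forall y, q y = A *m y + b) -> grad q x = A.
Proof.
move=> qE; apply/matrixP => i j; rewrite mxE.
suff -> : 'D_(delta_mx j 0) q x = col j A by rewrite mxE.
rewrite colE; apply: cvg_lim; first exact: norm_hausdorff.
(* The difference quotient of an affine map is constant for h different from 0. *)
apply: cvg_near_cst; near=> h.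
have h0 : h != 0 by near: h; exact: nbhs_dnbhs_neq.
rewrite /= !qE mulmxDr -scalemxAr opprD addrACA subrr addr0 addrK.
by rewrite scalerA mulVf // scale1r.
Unshelve. all: by end_near.
Qed.

Lemma P1_grad q : P1 q -> forall x, q x = grad q 0 *m x + q 0.
Proof.
by move=> [A [b qE]] x; rewrite (grad_affine 0 qE) !qE mulmx0 add0r.
Qed.

Lemma grad_P1 q x : P1 q -> grad q x = grad q 0.
Proof. by move=> [A [b qE]]; rewrite !(grad_affine _ qE). Qed.

Lemma strain_P1 q x : P1 q -> strain q x = strain q 0.
Proof. by move=> Pq; rewrite /strain (grad_P1 x Pq). Qed.

Lemma frobC A B : frob A B = frob B A.
Proof. by apply: eq_bigr => i _; apply: eq_bigr => j _; rewrite mulrC. Qed.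

Lemma frobDl A A' B : frob (A + A') B = frob A B + frob A' B.
Proof.
rewrite -big_split; apply: eq_bigr => i _ /=; rewrite -big_split.
by apply: eq_bigr => j _; rewrite mxE mulrDl.
Qed.

Lemma frobZl a A B : frob (a *: A) B = a * frob A B.
Proof.
rewrite mulr_sumr; apply: eq_bigr => i _; rewrite mulr_sumr.
by apply: eq_bigr => j _; rewrite mxE mulrA.
Qed.

Lemma frob_scalar a B : frob a%:M B = a * \tr B.
Proof.
rewrite /mxtrace mulr_sumr; apply: eq_bigr => i _; rewrite (bigD1 i) //= mxE eqxx.
by rewrite big1 ?addr0 // => j /negPf ji; rewrite mxE eq_sym ji mul0r.
Qed.

Lemma frob_tr A B : frob A^T B = frob A B^T.
Proof.
rewrite /frob exchange_big /=.
by apply: eq_bigr => i _; apply: eq_bigr => j _; rewrite !mxE.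
Qed.

Lemma frob_hooke mu lambda A B :
  frob (hooke mu lambda A) B = frob A (hooke mu lambda B).
Proof.
rewrite [RHS]frobC /hooke !frobDl !frobZl !frob_scalar (frobC B A).
by congr (_ + _); rewrite mulrAC.
Qed.

Lemma hooke_sym mu lambda A : A^T = A -> (hooke mu lambda A)^T = hooke mu lambda A.
Proof. by move=> As; rewrite /hooke linearD linearZ /= As tr_scalar_mx. Qed.

Lemma strain_sym q x : (strain q x)^T = strain q x.
Proof. by rewrite /strain linearZ linearD /= trmxK addrC. Qed.

(** A symmetric matrix is orthogonal to the skew part of the gradient. *)
Lemma frob_strain A q x : A^T = A -> frob A (strain q x) = frob A (grad q x).
Proof.
move=> As; rewrite frobC /strain frobZl frobDl frob_tr As [RHS]frobC; lra.
Qed.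

(** The hypothesis says that the p_i g_i^T sum to the identity, so the left-hand side is the trace
    of A^T B. The proof applies it to each column of A^T. *)
Lemma frob_sum_rank1 (I : finType) (P : pred I) (p g : I -> 'cV[R]_d) A B :
  (forall x, \sum_(i | P i) dot (g i) x *: p i = x) ->
  \sum_(i | P i) dot (A *m g i) (B *m p i) = frob A B.
Proof.
move=> pg.
transitivity (\sum_(i | P i) \sum_j dot (g i) (A^T *m delta_mx j 0) * (B *m p i) j 0).
  apply: eq_bigr => i _; rewrite {1}/dot; apply: eq_bigr => j _.
  by rewrite dot_mulmx trmxK dot_delta.
rewrite exchange_big /=; apply: eq_bigr => j _.
have := pg (A^T *m delta_mx j 0) => /(congr1 (fun y => (B *m y) j 0)).
rewrite mulmx_sumr summxE => e.
transitivity ((B *m (A^T *m (delta_mx j 0 : 'cV[R]_d))) j 0).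
  by rewrite -e; apply: eq_bigr => i _; rewrite -scalemxAr [in RHS]mxE.
rewrite -colE mxE; apply: eq_bigr => l _.
by rewrite !mxE mulrC.
Qed.

End Elasticity.

(** * Divergence theorem on cells and evaluation of the bilinear form *)

Section Orthogonality.
Context {R : realType} {d : nat}.
Variable M : mesh R d.
Hypothesis d_gt0 : (0 < d)%N.
Implicit Types (E T : {set vertex M}) (q u v w z : 'cV[R]_d -> 'cV[R]_d).
Local Notation bar := (bary (pt M)).

Lemma sum_faces_of_cell (F : {set vertex M} -> R) T : T \in cells M ->
  \sum_(E in faces M | E \subset T) F E = \sum_(a in T) F (T :\ a).
Proof.
move=> TM; rewrite -(big_imset F (h := fun a => T :\ a)) /=; last first.
  move=> a b aT bT ab; apply/eqP/negPn/negP => nab.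
  by have : a \in T :\ b; [rewrite !inE nab|rewrite -ab !inE eqxx].
apply: eq_bigl => E; apply/andP/imsetP => [[EM ET]|[a aT ->]].
  by have [a] := face_opposite EM TM ET; exists a.
by rewrite faceD1 // subD1set.
Qed.

(* The outward area vector of the face opposite to a is -d |T| grad lambda_a. *)
Lemma area_normal T g k a : T \in cells M -> is_barycentric (pt M) T g k ->
  a \in T ->
  (area (pt M) (T :\ a) * - Num.sg (height (T :\ a) T)) *: normal M (T :\ a) =
  (- (d%:R * area (pt M) T)) *: g a.
Proof.
move=> TM gk aT; have EM := faceD1 TM aT; have nE := normal_orthogonal EM.
have nn := normal_dot EM; have E0 := face_neq0 d_gt0 EM.
have [_ hE] := area_face d_gt0 (cell_independent TM) (card_cell TM) aT nn nE.
have [j jE] : exists j, j \in T :\ a by apply/set0Pn.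
have hj : dot (normal M (T :\ a)) (pt M a - bar (T :\ a)) =
    dot (normal M (T :\ a)) (pt M a - pt M j).
  rewrite -[RHS]addr0 -(normal_vertex E0 nE jE) -dotDr.
  by rewrite addrA subrK.
rewrite heightE // sgrM gtr0_sg ?invr_gt0 ?ltr0n // mul1r.
rewrite [X in _ *: X](normal_grad gk aT E0 nE) scalerA; congr (_ *: _).
rewrite -(hE j jE) hj normrEsg; ring.
Qed.

(** Divergence theorem with constant A; the factor [- Num.sg (height E T)] turns the fixed normal
    outward from T. *)
Lemma cell_divergence T A q : T \in cells M -> P1 q ->
  area (pt M) T * frob A (grad q 0) =
  \sum_(E in faces M | E \subset T)
    area (pt M) E * - Num.sg (height E T) * dot (A *m normal M E) (q (bar E)).
Proof.
move=> TM Pq; rewrite sum_faces_of_cell //.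
have [g [k gk]] := cell_coord TM.
under eq_bigr => a aT do
  rewrite -dotZl scalemxAr (area_normal TM gk aT) -scalemxAr dotZl.
rewrite -mulr_sumr -(frob_sum_rank1 _ _ (sum_grad_pt gk)).
have -> : \sum_(i in T) dot (A *m g i) (q (bar (T :\ i))) =
    d%:R^-1 * \sum_(i in T) dot (A *m g i) (d%:R *: q (bar (T :\ i))).
  rewrite mulr_sumr; apply: eq_bigr => i _.
  by rewrite dotZr mulrA mulVf ?mul1r // pnatr_eq0 -lt0n.
rewrite mulrA mulNr -mulrA [area _ _ / _]mulrC mulrA divff ?pnatr_eq0 -?lt0n //.
rewrite mul1r mulNr -mulrN; congr (_ * _).
(* d times the value of q at the barycenter opposite to i is Q minus the linear part at vertex i.
   The common Q drops out since the gradients sum to 0. *)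
set Q := \sum_(i in T) q (pt M i) - q 0.
transitivity (- (\sum_(i in T) (dot (A *m g i) Q
   - dot (A *m g i) (grad q 0 *m pt M i)))); last first.
  congr (- _); apply: eq_bigr => i iT; rewrite (P1_bary d_gt0 TM Pq iT).
  by rewrite -dotBr (P1_grad Pq (pt M i)) opprD addrA [in RHS]addrAC.
rewrite sumrB -dot_suml -mulmx_sumr (sum_grad gk) mulmx0 dot0l sub0r opprK.
by [].
Qed.

Variables (mu lambda alpha0 : R).
(** Stress on a cell and averaged traction on a face are constant for fields of [VDG], so they are
    read off at the origin. *)
Local Notation sigma u T := (stress (M := M) mu lambda u T 0).
Local Notation tract u E := (average E (traction (M := M) mu lambda u E) 0).

Lemma stress_cst u T x : VDG M u -> T \in cells M ->
  stress (M := M) mu lambda u T x = sigma u T.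
Proof. by move=> uV TM; rewrite /stress strain_P1 //; case: (restrP uV TM). Qed.

Lemma average_traction_cst u E x : VDG M u -> E \in faces M ->
  average E (traction (M := M) mu lambda u E) x = tract u E.
Proof.
move=> uV EM; rewrite /average /traction; have [EI|Eb] := face_cases EM.
  have [[pM _ _] [mM _ _]] := interior_cells d_gt0 EI.
  by rewrite EI !(stress_cst x uV).
have [pM _] := boundary_cell d_gt0 Eb.
by rewrite (interiorF_boundary Eb) (stress_cst x uV).
Qed.

(** Every integrand is constant or affine, a constant traction or mean jump being paired with an
    affine jump, so evaluation at the barycenter is exact. *)
Lemma A0E u w : VDG M u -> VDG M w -> A0 M mu lambda alpha0 u w =
  \sum_(T in cells M) area (pt M) T * frob (sigma u T) (strain (restr w T) 0)
  - \sum_(E in faces M | interior_face E || dirichlet_face E)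
      area (pt M) E * (dot (tract u E) (jump E (restr w) (bar E))
        + dot (jump E (restr u) (bar E)) (tract w E))
  + alpha0 * beta0 (d := d) mu lambda *
    \sum_(E in faces M | interior_face E || dirichlet_face E)
      (diam (simplex (pt M) E))^-1 *
      (area (pt M) E *
        dot (jump E (restr u) (bar E)) (jump E (restr w) (bar E))).
Proof.
move=> uV wV; rewrite /A0; congr (_ - _ + _ * _).
- apply: eq_bigr => T TM.
  have -> : (fun x => frob (stress mu lambda u T x) (strain (restr w T) x)) =
      fun=> frob (sigma u T) (strain (restr w T) 0).
    apply/funext => x; rewrite (stress_cst x uV TM).
    by rewrite (strain_P1 x (proj1 (restrP wV TM))).
  by rewrite integral_affine ?cell_neq0 //; exact: affine_cst.
- apply: eq_bigr => E /andP[EM _].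
  have -> : (fun x => dot (average E (traction mu lambda u E) x) (jump E (restr w) x)
        + dot (jump E (restr u) x) (average E (traction mu lambda w E) x)) =
      fun x => dot (tract u E) (jump E (restr w) x)
        + dot (tract w E) (jump E (restr u) x).
    (* Explicit congruences here and in A0C: rewriting would compare the traces
       of u and w by unfolding them. *)
    apply/funext => x; apply: f_equal2.
      exact: (f_equal2 dot (average_traction_cst x uV EM) (erefl _)).
    apply: etrans (dotC _ _) _.
    exact: (f_equal2 dot (average_traction_cst x wV EM) (erefl _)).
  rewrite integral_affine ?face_neq0 //; last first.
    by apply: affineD; apply: affine_dot; apply: P1_jump.
  apply: (f_equal2 *%R (erefl _)); apply: (f_equal2 +%R (erefl _)).
  exact: dotC.
- apply: eq_bigr => E /andP[EM _]; congr (_ * _).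
  rewrite (P0_affine d_gt0 EM (P1_jump d_gt0 wV EM)).
  under [X in integral_simplex _ _ X]funext do rewrite dotC.
  rewrite integral_affine ?face_neq0 //; first by rewrite dotC.
  by apply: affine_dot; exact: P1_jump.
Qed.

(** The elasticity tensor is self-adjoint, and after integration the one-sided projection in the
    penalty has become a product of two mean jumps. *)
Lemma A0C u w : VDG M u -> VDG M w ->
  A0 M mu lambda alpha0 u w = A0 M mu lambda alpha0 w u.
Proof.
move=> uV wV; rewrite (A0E uV wV) (A0E wV uV).
apply: f_equal2; last apply: (f_equal2 *%R (erefl _)).
  apply: f_equal2; last apply: (f_equal (fun y => - y)).
- apply: eq_bigr => T TM; apply: (f_equal2 *%R (erefl _)).
  exact: (etrans (frob_hooke _ _ _ _) (frobC _ _)).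
- apply: eq_bigr => E _; apply: (f_equal2 *%R (erefl _)).
  apply: etrans (addrC _ _) _; apply: f_equal2; exact: dotC.
- apply: eq_bigr => E _; do 2![apply: (f_equal2 *%R (erefl _))].
  exact: dotC.
Qed.

(** Interface identity for traces - c and c of zero average: the term pairing the jump of the
    tractions a, b with the average of the traces drops out. *)
Lemma dot_average_jump (s : R) (a b c : 'cV[R]_d) :
  s * - -1 * dot a (- c) + s * - 1 * dot b c =
  s * dot (2^-1 *: (a + b)) (- c - c).
Proof. rewrite dotZl dotDl !(dotBr, dotNr); lra. Qed.

(** Integration by parts on each cell, regrouped by faces: interior faces leave averaged traction
    times jump, Dirichlet faces traction times trace, and Neumann faces nothing since the mean trace
    of z vanishes there. *)
Lemma volume_term u z : VDG M u -> VZ M z ->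
  \sum_(T in cells M) area (pt M) T * frob (sigma u T) (strain (restr z T) 0) =
  \sum_(E in faces M | interior_face E || dirichlet_face E)
    area (pt M) E * dot (tract u E) (jump E (restr z) (bar E)).
Proof.
move=> uV zZ; have zV : VDG M z by case: zZ.
transitivity (\sum_(T in cells M) \sum_(E in faces M | E \subset T)
   area (pt M) E * - Num.sg (height E T) *
   dot (sigma u T *m normal M E) (restr z T (bar E))).
  apply: eq_bigr => T TM; rewrite frob_strain; last first.
    by rewrite /stress hooke_sym // strain_sym.
  by rewrite cell_divergence //; case: (restrP zV TM).
rewrite (exchange_big_dep (mem (faces M))) /=; last by move=> T E _ /andP[].
rewrite [RHS]big_mkcondr; apply: eq_bigr => E EM.
rewrite (eq_bigl (fun T => (T \in cells M) && (E \subset T))); last first.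
  by move=> T; rewrite EM.
have [EI|Eb] := face_cases EM.
  have [[pM Ep hp] [mM Em hm]] := interior_cells d_gt0 EI.
  (* The normal points out of the plus cell, of negative height, and into the minus cell. *)
  rewrite EI sum_cells_interior // (ltr0_sg hp) (gtr0_sg hm).
  have := VZ_average d_gt0 zZ (E := E); rewrite EI => /(_ isT).
  rewrite /average /jump /traction EI => /eqP.
  rewrite scaler_eq0 invr_eq0 pnatr_eq0 /= addr_eq0 => /eqP ->.
  exact: dot_average_jump.
have [pM Ep] := boundary_cell d_gt0 Eb.
rewrite sum_cells_boundary // (ltr0_sg (boundary_height d_gt0 Eb pM Ep)).
rewrite interiorF_boundary //= dirichlet_neumann //.
rewrite /average /jump /traction interiorF_boundary // opprK mulr1.
case: ifPn => // /negPn EN; have := VZ_average d_gt0 zZ (E := E).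
rewrite EN orbT /average interiorF_boundary // => /(_ isT) ->.
by rewrite dot0r mulr0.
Qed.

(** [volume_term] cancels the half of the consistency term that carries the traction of v; the other
    half and the penalty contain the mean jump of v. *)
Lemma A0_orthogonal v z : VCR M v -> VZ M z -> A0 M mu lambda alpha0 v z = 0.
Proof.
move=> vC zZ; have vV : VDG M v by case: vC.
have zV : VDG M z by case: zZ.
rewrite A0E // volume_term // -sumrB !big1 ?mulr0 ?addr0 // => E /andP[_ EID].
  by rewrite (VCR_jump d_gt0 vC EID) dot0l mulr0 mulr0.
by rewrite (VCR_jump d_gt0 vC EID) dot0l addr0 subrr.
Qed.

End Orthogonality.

Theorem lemma3p2 (R : realType) (d : nat) (hd : d = 2%N \/ d = 3%N)
    (M : mesh R d) (mu lambda alpha0 : R)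
    (hmu : 0 < mu) (hlambda : 0 <= lambda) (halpha0 : 0 < alpha0) :
  [/\ (forall u, VDG M u <->
         exists v z, [/\ VCR M v, VZ M z & dg_eq M u (fun x => v x + z x)]),
      (forall u, VCR M u -> VZ M u -> dg_eq M u (fun=> 0)) &
      (forall v z, VCR M v -> VZ M z ->
         A0 M mu lambda alpha0 v z = 0 /\ A0 M mu lambda alpha0 z v = 0)].
Proof.
have d_gt0 : (0 < d)%N by case: hd => ->.
split=> [u|u|v z vC zZ].
- split=> [|[v [z [[vV _] [zV _] uvz]]] T TM]; first exact: VDG_decomposition.
  have [q Pq vq] := vV T TM; have [q' Pq' zq'] := zV T TM.
  exists (fun x => q x + q' x); first exact: P1D.
  by move=> x xT; rewrite (uvz T) // vq // zq'.
- exact: VCR_VZ_eq0.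
- have orth := A0_orthogonal d_gt0 mu lambda alpha0 vC zZ; split=> //.
  by rewrite A0C //; [case: zZ|case: vC].
Qed.
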